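(* The online algorithm ON (described in the context) is an optimal online algorithm, i.e. it attains the minimal competitive ratio: for every online algorithm $A$, $$\sup_{\sigma,\rho}\frac{T_{A}(\sigma,\rho)}{T_O(\sigma,\rho)}\;\ge\;\sup_{\sigma,\rho}\frac{T_{\mathrm{ON}}(\sigma,\rho)}{T_O(\sigma,\rho)},$$ where the suprema are over all transmitter energy arrival sequences $\sigma$ and receiver on-time arrival sequences $\rho$ for which the offline problem (P2) is solvable.
   Context: Model. A transmitter energy arrival sequence $\sigma$ consists of instants $0=\tau_0<\tau_1<\cdots$ and amounts $\mathcal{E}_i>0$ (finite or infinite sequence); $\mathcal{E}(t)=\sum_{i:\tau_i\le t}\mathcal{E}_i$. A receiver sequence $\rho$ consists of instants $0=r_0<r_1<\cdots$ and amounts $\Gamma_i>0$ of receiver on-time; $\Gamma(t)=\sum_{i:r_i\le t}\Gamma_i$. Batteries are infinite. Rate function. $g:[0,\infty)\to[0,\infty)$ is monotonically increasing, $g(0)=0$, $\lim_{p\to\infty}g(p)=\infty$, $g$ is concave, and $g(p)/p$ is convex and monotonically decreasing with $\lim_{p\to\infty}g(p)/p=0$. Problem (P2). A policy uses power $p_i\ge0$ on $[s_i,s_{i+1}]$, $i=1,\dots,N$, with $0\le s_1<\cdots<s_{N+1}$; the receiver is on exactly when the power is nonzero. $U(t),B(t),C(t)$ are the energy used, bits sent (at rate $g(\text{power})$) and receiver on-time used up to time $t$. Given $B_0>0$, minimize the finish time $T=s_{N+1}$ subject to $B(T)=B_0$, $U(t)\le\mathcal{E}(t)$ and $C(t)\le\Gamma(t)$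 for all $t\in[0,T]$. $T_O(\sigma,\rho)$ is the minimum (offline optimal) finish time. Online algorithms. An online algorithm $A$ produces, for each input $(\sigma,\rho)$, transmissions obeying the energy and on-time constraints of (P2), where the decisions up to time $t$ depend only on the arrivals (instants and amounts) up to time $t$; no distributional information is available. $T_A(\sigma,\rho)$ is the time at which $A$ completes the transmission of $B_0$ bits ($\infty$ if it never does). The competitive ratio of $A$ is the worst-case value of $T_A(\sigma,\rho)/T_O(\sigma,\rho)$ over inputs, and an optimal online algorithm is one minimizing it. Algorithm ON. Let $T_{\mathrm{start}}=\min\{t:\Gamma(t)\,g(\mathcal{E}(t)/\Gamma(t))\ge B_0\}$. From $T_{\mathrm{start}}$ transmit with the power $l_1$ given by $\frac{\mathcal{E}(T_{\mathrm{start}})}{l_1}g(l_1)=B_0$. At every transmitter energy arrival epoch $\tau_j>T_{\mathrm{start}}$ before completion, change the power to the value $l$ given by $\frac{E_{\mathrm{rem}}(\tau_j)}{l}g(l)=B_{\mathrm{rem}}(\tau_j)$, where $E_{\mathrm{rem}}(\tau_j)$ is the energy left at the transmitter at $\tau_j$ (including the new arrival) and $B_{\mathrm{rem}}(\tau_j)$ is the number of bits remaining. Powers are not changed at receiver arrivals. Stop when $B_0$ bits are sent; the finish time is $T_{\mathrm{ON}}(\sigma,\rho)$. *)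

(* Defs.v *)
From Stdlib Require Import Reals ClassicalEpsilon.
From Coquelicot Require Import Coquelicot.
Open Scope R_scope.

Definition convex_on (D : R -> Prop) (f : R -> R) : Prop :=
  forall x y t, D x -> D y -> 0 <= t <= 1 ->
    f (t * x + (1 - t) * y) <= t * f x + (1 - t) * f y.

Definition concave_on (D : R -> Prop) (f : R -> R) : Prop :=
  forall x y t, D x -> D y -> 0 <= t <= 1 ->
    t * f x + (1 - t) * f y <= f (t * x + (1 - t) * y).

(* Only the values of [g] on [0, +oo) matter.  The two monotonicity clauses are
   the weak ones: together with concavity, convexity and the limits they imply
   strict monotonicity of both [g] and [g p / p]. *)
Record rate_function (g : R -> R) : Prop := {
  rate_nonneg : forall p, 0 <= p -> 0 <= g p;
  rate_0 : g 0 = 0;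
  rate_increasing : forall p q, 0 <= p -> p <= q -> g p <= g q;
  rate_unbounded : is_lim g p_infty p_infty;
  rate_concave : concave_on (fun p => 0 <= p) g;
  rate_ratio_convex : convex_on (fun p => 0 < p) (fun p => g p / p);
  rate_ratio_decreasing :
    forall p q, 0 < p -> p <= q -> g q / q <= g p / p;
  rate_ratio_lim : is_lim (fun p => g p / p) p_infty 0
}.

(* [arrival a i] is the pair (instant, amount) of the [i]-th arrival, or [None]
   if the sequence is finite and has no [i]-th arrival.  An infinite sequence
   has only finitely many arrivals in a bounded time interval. *)
Record arrivals := {
  arrival :> nat -> option (R * R);
  arrival_first : exists x, arrival 0%nat = Some (0, x);
  arrival_increasing : forall i t' x', arrival (S i) = Some (t', x') ->
    exists t x, arrival i = Some (t, x) /\ t < t';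
  arrival_positive : forall i t x, arrival i = Some (t, x) -> 0 < x;
  arrival_locally_finite : forall T, exists n, forall i t x,
    (n <= i)%nat -> arrival i = Some (t, x) -> T < t
}.

(* The series has finitely many nonzero terms. *)
Definition total (a : arrivals) (t : R) : R :=
  Series (fun i => match a i with
                   | Some (u, x) => if Rle_dec u t then x else 0
                   | None => 0
                   end).

Definition same_until (t : R) (a b : arrivals) : Prop :=
  forall i u x, u <= t -> (a i = Some (u, x) <-> b i = Some (u, x)).

(* A transmission is described by its power [P t] at each time [t >= 0]. *)

Definition energy_used (P : R -> R) (t : R) : R := RInt P 0 t.

Definition bits_sent (g P : R -> R) (t : R) : R :=
  RInt (fun u => g (P u)) 0 t.

Definition on_time (P : R -> R) (t : R) : R :=
  RInt (fun u => if Req_EM_T (P u) 0 then 0 else 1) 0 t.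

(* [P] takes the constant value [p i >= 0] between [s i] and [s (S i)], for
   [i < N], where [a = s 0 < ... < s N = b]. *)
Definition powers_on (a b : R) (P : R -> R) : Prop :=
  exists (N : nat) (s p : nat -> R),
    s 0%nat = a /\ s N = b /\
    forall i, (i < N)%nat ->
      s i < s (S i) /\ 0 <= p i /\
      forall t, s i <= t < s (S i) -> P t = p i.

Definition respects (sigma rho : arrivals) (P : R -> R) (t : R) : Prop :=
  energy_used P t <= total sigma t /\ on_time P t <= total rho t.

(* A policy starting at [s] and finishing at [T]. *)
Definition policy (s T : R) (P : R -> R) : Prop :=
  0 <= s < T /\ powers_on s T P /\ forall t, t < s \/ T <= t -> P t = 0.

Definition offline_feasible (g : R -> R) (B0 : R) (sigma rho : arrivals)
    (T : R) : Prop :=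
  exists s P, policy s T P /\ bits_sent g P T = B0 /\
    forall t, 0 <= t <= T -> respects sigma rho P t.

Definition offline_optimum (g : R -> R) (B0 : R) (sigma rho : arrivals)
    (T : R) : Prop :=
  offline_feasible g B0 sigma rho T /\
  forall T', offline_feasible g B0 sigma rho T' -> T <= T'.

Definition algorithm := arrivals -> arrivals -> R -> R.

(* The power in use at time [t] may react to an arrival at [t] itself. *)
Record online (A : algorithm) : Prop := {
  online_powers : forall sigma rho T, 0 < T -> powers_on 0 T (A sigma rho);
  online_respects : forall sigma rho t, 0 <= t ->
    respects sigma rho (A sigma rho) t;
  online_causal : forall t sigma sigma' rho rho',
    same_until t sigma sigma' -> same_until t rho rho' ->
    forall u, 0 <= u <= t -> A sigma rho u = A sigma' rho' u
}.

(* [p_infty] if fewer than [B0] bits are ever sent. *)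
Definition finish_time (g : R -> R) (B0 : R) (P : R -> R) : Rbar :=
  Glb_Rbar (fun t => 0 <= t /\ B0 <= bits_sent g P t).

(* The supremum ranges over the inputs for which the offline problem has an
   optimal finish time [TO]; such a [TO] is unique and positive. *)
Definition competitive_ratio (g : R -> R) (B0 : R) (A : algorithm) : Rbar :=
  Rbar_lub (fun r => exists sigma rho TO,
    offline_optimum g B0 sigma rho TO /\
    r = Rbar_div (finish_time g B0 (A sigma rho)) (Finite TO)).

Definition optimal_online (g : R -> R) (B0 : R) (A : algorithm) : Prop :=
  online A /\
  forall A', online A' ->
    Rbar_le (competitive_ratio g B0 A) (competitive_ratio g B0 A').

Section ON.

Variables (g : R -> R) (B0 : R) (sigma rho : arrivals).

(* The set is a locally finite union of intervals closed on the left, so the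
   greatest lower bound is attained; it is [p_infty] if the set is empty. *)
Definition T_start : Rbar :=
  Glb_Rbar (fun t => 0 <= t /\
    B0 <= total rho t * g (total sigma t / total rho t)).

(* The power that spends the energy [e] exactly while sending [b] bits. *)
Definition exhausting_power (e b : R) : R :=
  epsilon (inhabits 0) (fun l => 0 < l /\ e / l * g l = b).

(* First energy arrival instant after [t]; [p_infty] if there is none. *)
Definition next_arrival (t : R) : Rbar :=
  Glb_Rbar (fun u => t < u /\ exists i x, sigma i = Some (u, x)).

(* [ON_phase m = Some (t, e, b)]: the power is set for the [m]-th time at [t],
   when the energy left is [e] and [b] bits remain. *)
Fixpoint ON_phase (m : nat) : option (R * R * R) :=
  match m with
  | O => match T_start with
         | Finite t => Some (t, total sigma t, B0)
         | _ => None
         end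
  | S m' =>
    match ON_phase m' with
    | Some (t, e, b) =>
      let l := exhausting_power e b in
      match next_arrival t with
      | Finite t' =>
        if Rlt_dec t' (t + b / g l) then
          Some (t', e - l * (t' - t) + (total sigma t' - total sigma t),
                b - g l * (t' - t))
        else None
      | _ => None
      end
    | None => None
    end
  end.

(* At time [u] the power [l] is in use: [u] falls in a phase, before the next
   energy arrival and before completion. *)
Definition ON_transmits (u l : R) : Prop :=
  exists m t e b, ON_phase m = Some (t, e, b) /\
    l = exhausting_power e b /\
    t <= u < t + b / g l /\ Rbar_lt u (next_arrival t).

Definition ON_power (u : R) : R :=
  match excluded_middle_informative (exists l, ON_transmits u l) with
  | left ex => proj1_sig (constructive_indefinite_description _ ex)
  | right _ => 0
  end.

End ON.

Definition ON (g : R -> R) (B0 : R) : algorithm :=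
  fun sigma rho => ON_power g B0 sigma rho.

(* Main.v *)
(* Both sides have the value 2.  Write h(p) = g(p)/p, which is strictly
   decreasing.

   Upper bound.  Let T be the offline optimum.  By concavity the resources that
   arrived by T suffice for B0 bits, so ON has started by T, and
   B0 <= T g(E/T) = E h(E/T) with E the energy arrived by T.  The powers of ON
   increase, so all its bits are sent at ratio at least h(l), with l the power
   in use at T: E h(l) <= B0.  Hence l >= E/T, the energy left at T lasts at
   most T, and later arrivals only advance the completion.

   Lower bound.  Let q be the last contact point of a supporting line of g, and
   q' > q close to q; D and D' < D are the on-times for which the constant powers
   q and q' send B0 bits.  Energy q D and on-time G = 2 D' - D are available at
   time 0.  If the algorithm is silent before G, the missing on-time D - G
   arrives at G: the optimum is D, while the algorithm needs D more time units.
   With these totals only power q reaches B0 bits, so an algorithm using another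
   power before G never finishes.  One using power q is given instead the
   totals q' D' and D', with which power q is wasteful: two supporting lines
   through the same point coincide since h is convex.  The ratio is thus at
   least (G + D)/D = 2 g(q)/g(q'), which tends to 2 as q' tends to q. *)

Require Import Defs.
From Stdlib Require Import Reals Lra Lia ClassicalEpsilon Classical.
From Coquelicot Require Import Coquelicot.
Open Scope R_scope.

(** * Rate functions *)

Section Rate.

Variable g : R -> R.
Hypothesis hg : rate_function g.

Lemma rate_exceeds M p : exists q, p < q /\ M < g q.
Proof.
  destruct (proj2 (is_lim_spec _ _ _) (rate_unbounded _ hg) M) as [A HA].
  exists (Rmax A p + 1). pose proof (Rmax_l A p). pose proof (Rmax_r A p).
  split; [lra|]. apply HA. lra.
Qed.

Lemma ratio_falls_below eps p :
  0 < eps -> exists q, p < q /\ 0 < q /\ g q / q < eps.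
Proof.
  intros He.
  destruct (proj2 (is_lim_spec _ _ _) (rate_ratio_lim _ hg) (mkposreal _ He))
    as [A HA].
  exists (Rmax (Rmax A p) 0 + 1).
  pose proof (Rmax_l A p). pose proof (Rmax_r A p).
  pose proof (Rmax_l (Rmax A p) 0). pose proof (Rmax_r (Rmax A p) 0).
  split; [lra|]. split; [lra|].
  specialize (HA (Rmax (Rmax A p) 0 + 1) ltac:(lra)). simpl in HA.
  apply Rabs_def2 in HA. lra.
Qed.

(** Unboundedness gives [r > q] with [g r > g q]; by concavity [g q] is at least the value at [q] of
    the chord from [p] to [r], which is impossible if [g p >= g q]. *)
Lemma rate_strict p q : 0 <= p < q -> g p < g q.
Proof.
  intros [Hp Hq]. destruct (rate_exceeds (g q) q) as [r [Hr Hgr]].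
  pose proof (rate_concave _ hg p r ((r - q) / (r - p)) Hp ltac:(lra)) as H.
  assert (Ht : 0 < (q - p) / (r - p)) by (apply Rdiv_lt_0_compat; lra).
  assert (Hs : 0 < (r - q) / (r - p)) by (apply Rdiv_lt_0_compat; lra).
  assert (E : 1 - (r - q) / (r - p) = (q - p) / (r - p)) by (field; lra).
  assert (E2 : (r - q) / (r - p) * p + (q - p) / (r - p) * r = q)
    by (field; lra).
  rewrite E, E2 in H. specialize (H ltac:(lra)).
  assert (Es : (r - q) / (r - p) = 1 - (q - p) / (r - p)) by lra.
  rewrite Es in H, Hs. revert H Ht Hs. generalize ((q - p) / (r - p)).
  intros. nra.
Qed.

Lemma rate_pos p : 0 < p -> 0 < g p.
Proof. intros Hp. rewrite <- (rate_0 _ hg). apply rate_strict. lra. Qed.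

Lemma ratio_pos p : 0 < p -> 0 < g p / p.
Proof.
  intros Hp. apply Rdiv_lt_0_compat; [apply rate_pos|]; exact Hp.
Qed.

(** Mirror image for the convex ratio: a far point [r] with a smaller ratio than [p] pulls the
    chord, hence the ratio at [q], strictly below the ratio at [p]. *)
Lemma ratio_strict p q : 0 < p < q -> g q / q < g p / p.
Proof.
  intros [Hp Hq].
  destruct (ratio_falls_below (g p / p) q (ratio_pos p Hp)) as [r [Hr [_ Hgr]]].
  pose proof (rate_ratio_convex _ hg p r ((r - q) / (r - p)) Hp ltac:(lra)) as H.
  assert (Ht : 0 < (q - p) / (r - p)) by (apply Rdiv_lt_0_compat; lra).
  assert (Hs : 0 < (r - q) / (r - p)) by (apply Rdiv_lt_0_compat; lra).
  assert (E : 1 - (r - q) / (r - p) = (q - p) / (r - p)) by (field; lra).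
  assert (E2 : (r - q) / (r - p) * p + (q - p) / (r - p) * r = q)
    by (field; lra).
  rewrite E, E2 in H. specialize (H ltac:(lra)).
  assert (Es : (r - q) / (r - p) = 1 - (q - p) / (r - p)) by lra.
  rewrite Es in H, Hs. revert H Ht Hs. generalize ((q - p) / (r - p)).
  intros. nra.
Qed.

Lemma ratio_le_inv p q : 0 < p -> 0 < q -> g p / p <= g q / q -> q <= p.
Proof.
  intros Hp Hq H. destruct (Rle_or_lt q p) as [L|L]; [exact L|].
  pose proof (ratio_strict p q (conj Hp L)). lra.
Qed.

Lemma ratio_inj p q : 0 < p -> 0 < q -> g p / p = g q / q -> p = q.
Proof.
  intros Hp Hq H. apply Rle_antisym; apply ratio_le_inv; lra.
Qed.

(** An intermediate value argument that avoids continuity: [l] is the supremum of the points from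
    [l0] on where [g] is above the line of slope [k] through the origin, and monotonicity of [g]
    settles both inequalities there. *)
Lemma ratio_surj k l0 :
  0 < l0 -> 0 < k <= g l0 / l0 -> exists l, l0 <= l /\ g l / l = k.
Proof.
  intros Hl0 Hk. pose (S := fun p => l0 <= p /\ k * p <= g p).
  assert (HS0 : S l0).
  { split; [lra|]. apply Rle_div_r; lra. }
  destruct (ratio_falls_below k l0 (proj1 Hk)) as [A [_ [HA HgA]]].
  destruct (completeness S) as [l [Hub Hlub]].
  - exists A. intros p [Hp Hgp]. apply (ratio_le_inv A p); try lra.
    apply Rle_trans with k; [lra|]. apply Rle_div_r; lra.
  - exists l0. exact HS0.
  - assert (Hl : l0 <= l) by (apply Hub, HS0).
    exists l. split; [exact Hl|]. apply Rle_antisym.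
    + (* [g] is monotone and lies below [k q] for [q > l] *)
      apply Rle_div_l; [lra|].
      destruct (Rle_or_lt (g l) (k * l)) as [L|L]; [exact L|].
      (* The midpoint satisfies [k * q < g l <= g q], so it would belong to [S] although it exceeds
         the supremum. *)
      pose (q := (l + g l / k) / 2).
      assert (Hgk : l < g l / k) by (apply Rlt_div_r; lra).
      assert (Hkk : k * (g l / k) = g l) by (field; lra).
      assert (Hq : l < q) by (unfold q; lra).
      assert (Hgq : g l <= g q) by (apply (rate_increasing _ hg); lra).
      assert (HSq : S q).
      { split; [lra|]. unfold q in *. nra. }
      pose proof (Hub q HSq). lra.
    + apply Rle_div_r; [lra|].
      assert (l <= g l / k).
      { apply Hlub. intros p [Hp Hgp].
        assert (p <= l) by (apply Hub; split; assumption).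
        assert (g p <= g l) by (apply (rate_increasing _ hg); lra).
        apply Rle_div_r; lra. }
      assert (Hkk : k * (g l / k) = g l) by (field; lra). nra.
Qed.

(** Here [c] acts as a price per unit of receiver on-time and [m] as a price per unit of energy: no
    power sends more bits than the resources it consumes are worth, and power [x] breaks even. *)
Definition supporting (c m x : R) : Prop :=
  0 < c /\ 0 < m /\ g x = c + m * x /\ forall p, 0 <= p -> g p <= c + m * p.

Lemma chord_slopes y x p :
  0 <= y < x -> x < p -> (g p - g x) / (p - x) <= (g x - g y) / (x - y).
Proof.
  intros [Hy Hx] Hp.
  pose proof (rate_concave _ hg y p ((p - x) / (p - y)) Hy ltac:(lra)) as H.
  assert (Ht : 0 < (x - y) / (p - y)) by (apply Rdiv_lt_0_compat; lra).
  assert (Hs : 0 < (p - x) / (p - y)) by (apply Rdiv_lt_0_compat; lra).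
  assert (E : 1 - (p - x) / (p - y) = (x - y) / (p - y)) by (field; lra).
  assert (E2 : (p - x) / (p - y) * y + (x - y) / (p - y) * p = x)
    by (field; lra).
  rewrite E, E2 in H. specialize (H ltac:(lra)).
  apply Rle_div_l; [lra|].
  replace ((g x - g y) / (x - y) * (p - x))
    with ((g x - g y) * (p - x) / (x - y)) by (field; lra).
  apply Rle_div_r; [lra|].
  apply (Rmult_le_compat_r (p - y)) in H; [|lra].
  replace (((p - x) / (p - y) * g y + (x - y) / (p - y) * g p) * (p - y))
    with ((p - x) * g y + (x - y) * g p) in H by (field; lra).
  lra.
Qed.

(** The slope is the supremum of the chord slopes to the right of [x]; chords to the left are at
    least as steep, so the line works on both sides. *)
Lemma supporting_exists x : 0 < x -> exists c m, supporting c m x.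
Proof.
  intros Hx.
  pose (S := fun s => exists p, x < p /\ s = (g p - g x) / (p - x)).
  assert (HS0 : S ((g (x + 1) - g x) / (x + 1 - x))).
  { exists (x + 1). split; [lra|reflexivity]. }
  assert (Hub0 : forall y, 0 <= y < x -> is_upper_bound S ((g x - g y) / (x - y))).
  { intros y Hy s [p [Hp ->]]. apply chord_slopes; assumption. }
  destruct (completeness S) as [m [Hub Hlub]].
  - exists ((g x - g 0) / (x - 0)). apply Hub0. lra.
  - eexists. exact HS0.
  - assert (Hm : 0 < m).
    { apply Rlt_le_trans with (2 := Hub _ HS0).
      pose proof (rate_strict x (x + 1) ltac:(lra)).
      apply Rdiv_lt_0_compat; lra. }
    assert (Hline : forall p, 0 <= p -> g p <= g x - m * x + m * p).
    { intros p Hp. destruct (Rtotal_order p x) as [L|[->|L]].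
      - pose proof (Hlub _ (Hub0 p (conj Hp L))) as H.
        apply Rle_div_r in H; lra.
      - lra.
      - assert (H : (g p - g x) / (p - x) <= m) by (apply Hub; exists p; auto).
        apply Rle_div_l in H; lra. }
    exists (g x - m * x), m. repeat split; try assumption; [|lra].
    (* A nonpositive intercept would be 0, as [g 0 = 0], and the line would make the ratio at
       [x / 2] no larger than at [x]. *)
    destruct (Rlt_or_le 0 (g x - m * x)) as [L|L]; [exact L|exfalso].
    pose proof (Hline 0 ltac:(lra)) as H0. rewrite (rate_0 _ hg) in H0.
    pose proof (ratio_strict (x / 2) x ltac:(lra)) as Hs.
    pose proof (Hline (x / 2) ltac:(lra)) as H2.
    assert (E : g x / x = m) by (apply Rmult_eq_reg_r with x; [field_simplify|]; lra).
    rewrite E in Hs. apply Rlt_div_r in Hs; lra.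
Qed.

(* The last contact point of a supporting line. *)
Lemma exposed_exists :
  exists q c m, 0 < q /\ supporting c m q /\
    forall p, q < p -> g p < c + m * p.
Proof.
  destruct (supporting_exists 1 ltac:(lra)) as [c [m [Hc [Hm [H1 Hline]]]]].
  pose (S := fun p => 1 <= p /\ c + m * p <= g p).
  assert (HS1 : S 1) by (split; lra).
  destruct (ratio_falls_below m 1 Hm) as [A [_ [HA HgA]]].
  destruct (completeness S) as [q [Hub Hlub]].
  - exists A. intros p [Hp Hgp]. apply (ratio_le_inv A p); try lra.
    apply Rle_trans with m; [lra|]. apply Rle_div_r; lra.
  - exists 1. exact HS1.
  - assert (Hq : 1 <= q) by (apply Hub, HS1).
    assert (Hcont : c + m * q <= g q).
    { assert (q <= (g q - c) / m).
      { apply Hlub. intros p [Hp Hgp].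
        assert (p <= q) by (apply Hub; split; assumption).
        assert (g p <= g q) by (apply (rate_increasing _ hg); lra).
        apply Rle_div_r; lra. }
      apply Rle_div_r in H; lra. }
    exists q, c, m. split; [lra|]. split.
    + repeat split; try assumption.
      pose proof (Hline q ltac:(lra)). lra.
    + intros p Hp. destruct (Rlt_or_le (g p) (c + m * p)) as [L|L]; [exact L|].
      assert (S p) by (split; lra). pose proof (Hub p H). lra.
Qed.

(* Convexity of [g p / p] excludes a concave kink of [g]: two supporting lines
   through the same point coincide. *)
Lemma no_kink q c m c' m' :
  0 < q -> supporting c m q -> supporting c' m' q -> m <= m'.
Proof.
  intros Hq [Hc [Hm [E Hl]]] [Hc' [Hm' [E' Hl']]].
  destruct (Rle_or_lt m m') as [L|L]; [exact L|exfalso].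
  assert (Hcc : c < c') by nra.
  (* Bounding [g] by the steeper line at [q - d] and by the flatter one at [q + d], midpoint
     convexity yields [(c' - c) * q <= (c + c') * d]; this [d] is half the value giving equality. *)
  pose (d := (c' - c) * q / (2 * (c + c'))).
  assert (Hd : d * (2 * (c + c')) = (c' - c) * q) by (unfold d; field; lra).
  assert (Hd0 : 0 < d) by (apply Rdiv_lt_0_compat; nra).
  assert (Hdq : d < q) by nra.
  pose proof (rate_ratio_convex _ hg (q - d) (q + d) (1 / 2)
    ltac:(lra) ltac:(lra) ltac:(lra)) as H. simpl in H.
  replace (1 / 2 * (q - d) + (1 - 1 / 2) * (q + d)) with q in H by field.
  assert (H1 : g (q - d) / (q - d) <= c / (q - d) + m).
  { apply Rle_div_l; [lra|]. pose proof (Hl (q - d) ltac:(lra)).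
    replace ((c / (q - d) + m) * (q - d)) with (c + m * (q - d)) by (field; lra).
    lra. }
  assert (H2 : g (q + d) / (q + d) <= c' / (q + d) + m').
  { apply Rle_div_l; [lra|]. pose proof (Hl' (q + d) ltac:(lra)).
    replace ((c' / (q + d) + m') * (q + d)) with (c' + m' * (q + d))
      by (field; lra).
    lra. }
  assert (H3 : g q / q = c / q + m) by (rewrite E; field; lra).
  assert (H4 : g q / q = c' / q + m') by (rewrite E'; field; lra).
  assert (H5 : c / q + c' / q <= c / (q - d) + c' / (q + d)) by lra.
  assert (H6 : c' / q - c' / (q + d) = c' * d / (q * (q + d))) by (field; lra).
  assert (H7 : c / (q - d) - c / q = c * d / (q * (q - d))) by (field; lra).
  assert (H8 : c' * d / (q * (q + d)) <= c * d / (q * (q - d))) by lra.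
  apply (Rmult_le_compat_r (q * (q + d) * (q - d) / d)) in H8.
  2: { apply Rlt_le, Rdiv_lt_0_compat; [|lra].
       repeat apply Rmult_lt_0_compat; lra. }
  replace (c' * d / (q * (q + d)) * (q * (q + d) * (q - d) / d))
    with (c' * (q - d)) in H8 by (field; lra).
  replace (c * d / (q * (q - d)) * (q * (q + d) * (q - d) / d))
    with (c * (q + d)) in H8 by (field; lra).
  nra.
Qed.

(** This makes power [q] wasteful at the prices of [q']. If the line at [q'] also touched [g] at
    [q], its slope would be at least [m] by [no_kink], and its value at [q'] at least [c + m * q'],
    above [g q']. *)
Lemma exposed_misses q c m q' c' m' :
  0 < q < q' -> supporting c m q -> g q' < c + m * q' ->
  supporting c' m' q' -> g q < c' + m' * q.
Proof.
  intros [Hq Hqq'] HS Hlt [Hc' [Hm' [E' Hl']]].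
  destruct (Rlt_or_le (g q) (c' + m' * q)) as [L|L]; [exact L|exfalso].
  assert (Eq : g q = c' + m' * q) by (pose proof (Hl' q ltac:(lra)); lra).
  assert (HS' : supporting c' m' q) by (repeat split; assumption).
  pose proof (no_kink q c m c' m' Hq HS HS').
  destruct HS as [_ [_ [E _]]]. nra.
Qed.

End Rate.

(** * Integrals of piecewise constant powers *)

(** Pieces are closed on the left, so a power observed at one instant is held for a positive time.
    This is what lets a single deviation of an algorithm be penalised in an integral. *)
Lemma powers_on_piece a b P u :
  powers_on a b P -> a <= u < b ->
  0 <= P u /\ exists v, u < v <= b /\ forall w, u <= w < v -> P w = P u.
Proof.
  intros [N [s [p [Ha [Hb Hs]]]]] Hu.
  assert (Hmono : forall j i, (i + j <= N)%nat -> s i <= s (i + j)%nat).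
  { induction j as [|j IH]; intros i Hi.
    - replace (i + 0)%nat with i by lia. lra.
    - apply Rle_trans with (s (i + j)%nat); [apply IH; lia|].
      replace (i + S j)%nat with (S (i + j)) by lia.
      apply Rlt_le, Hs. lia. }
  assert (H : forall n, (n <= N)%nat -> u < s n ->
    exists i, (i < n)%nat /\ s i <= u < s (S i)).
  { induction n as [|n IH]; intros Hn Hun.
    - lra.
    - destruct (Rlt_or_le u (s n)) as [L|L].
      + destruct (IH ltac:(lia) L) as [i [Hi Hsi]]. exists i. split; [lia|exact Hsi].
      + exists n. split; [lia|]. lra. }
  destruct (H N ltac:(lia) ltac:(lra)) as [i [Hi Hsi]].
  destruct (Hs i Hi) as [_ [Hp HP]].
  assert (E : P u = p i) by (apply HP; exact Hsi).
  split; [lra|]. exists (s (S i)). split.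
  - split; [lra|]. rewrite <- Hb.
    replace N with (S i + (N - S i))%nat by lia. apply Hmono. lia.
  - intros w Hw. rewrite E. apply HP. lra.
Qed.

Lemma powers_on_nil a P : powers_on a a P.
Proof.
  exists 0%nat, (fun _ => a), (fun _ => 0). split; [reflexivity|].
  split; [reflexivity|]. intros i Hi. lia.
Qed.

Lemma powers_on_extend a b c p P :
  powers_on a b P -> b <= c -> 0 <= p -> (forall t, b <= t < c -> P t = p) ->
  powers_on a c P.
Proof.
  intros HP Hbc Hp Hc. destruct (Req_EM_T b c) as [<-|Hne]; [exact HP|].
  destruct HP as [N [s [q [Ha [Hb Hs]]]]].
  exists (S N), (fun i => if Nat.leb i N then s i else c),
    (fun i => if Nat.ltb i N then q i else p).
  split; [exact Ha|]. split.
  - destruct (Nat.leb_spec (S N) N); [lia|reflexivity].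
  - intros i Hi. destruct (Nat.leb_spec i N); [|lia].
    destruct (Nat.leb_spec (S i) N); destruct (Nat.ltb_spec i N); try lia.
    + apply Hs. lia.
    + replace i with N by lia. rewrite Hb. split; [lra|]. auto.
Qed.

Lemma powers_on_const a b p P :
  a <= b -> 0 <= p -> (forall t, a <= t < b -> P t = p) -> powers_on a b P.
Proof.
  intros. apply powers_on_extend with a p; try assumption. apply powers_on_nil.
Qed.

Lemma powers_on_concat a b c P :
  powers_on a b P -> powers_on b c P -> powers_on a c P.
Proof.
  intros Hab [N [s [p [Hb [Hc Hs]]]]].
  assert (H : forall n, (n <= N)%nat -> powers_on a (s n) P).
  { induction n as [|n IH]; intros Hn.
    - rewrite Hb. exact Hab.
    - destruct (Hs n ltac:(lia)) as [Hlt [Hp HP]].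
      apply powers_on_extend with (s n) (p n); try assumption; [|lra].
      apply IH. lia. }
  rewrite <- Hc. apply H. lia.
Qed.

Lemma ex_RInt_eq_const (f : R -> R) k a b :
  a <= b -> (forall t, a <= t < b -> f t = k) -> ex_RInt f a b.
Proof.
  intros Hab Hf. apply ex_RInt_ext with (fun _ => k).
  - intros x. rewrite Rmin_left, Rmax_right by exact Hab. intros Hx.
    symmetry. apply Hf. lra.
  - apply ex_RInt_const.
Qed.

Lemma RInt_eq_const (f : R -> R) k a b :
  a <= b -> (forall t, a <= t < b -> f t = k) -> RInt f a b = k * (b - a).
Proof.
  intros Hab Hf. rewrite (RInt_ext f (fun _ => k)).
  - rewrite RInt_const. unfold scal. simpl. unfold mult. simpl. ring.
  - intros x. rewrite Rmin_left, Rmax_right by exact Hab. intros Hx.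
    apply Hf. lra.
Qed.

Lemma powers_on_ex_RInt (phi : R -> R) a b P :
  powers_on a b P -> ex_RInt (fun t => phi (P t)) a b.
Proof.
  intros [N [s [p [Ha [Hb Hs]]]]].
  assert (H : forall n, (n <= N)%nat -> ex_RInt (fun t => phi (P t)) a (s n)).
  { induction n as [|n IH]; intros Hn.
    - rewrite Ha. apply ex_RInt_point.
    - destruct (Hs n ltac:(lia)) as [Hlt [Hp HP]].
      apply ex_RInt_Chasles with (s n); [apply IH; lia|].
      apply ex_RInt_eq_const with (phi (p n)); [lra|].
      intros t Ht. rewrite (HP t Ht). reflexivity. }
  rewrite <- Hb. apply H. lia.
Qed.

Lemma RInt_split (f : R -> R) a b c :
  a <= b <= c -> ex_RInt f a c -> RInt f a c = RInt f a b + RInt f b c.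
Proof.
  intros Hb Hf. symmetry. apply (RInt_Chasles (V := R_CompleteNormedModule)).
  - exact (ex_RInt_Chasles_1 f a b c Hb Hf).
  - exact (ex_RInt_Chasles_2 f a b c Hb Hf).
Qed.

Lemma RInt_power_nonneg (phi : R -> R) a b T P :
  powers_on 0 T P -> (forall p, 0 <= p -> 0 <= phi p) -> 0 <= a <= b -> b <= T ->
  0 <= RInt (fun t => phi (P t)) a b.
Proof.
  intros HP Hphi Hab HbT. apply RInt_ge_0; [lra| |].
  - apply (ex_RInt_Chasles_2 (fun t => phi (P t)) 0); [exact Hab|].
    apply (ex_RInt_Chasles_1 (fun t => phi (P t)) 0 b T); [lra|].
    apply powers_on_ex_RInt. exact HP.
  - intros t Ht. apply Hphi, (powers_on_piece 0 T P t HP). lra.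
Qed.

Lemma RInt_power_mono (phi : R -> R) t T P :
  powers_on 0 T P -> (forall p, 0 <= p -> 0 <= phi p) -> 0 <= t <= T ->
  RInt (fun u => phi (P u)) 0 t <= RInt (fun u => phi (P u)) 0 T.
Proof.
  intros HP Hphi Ht. rewrite (RInt_split _ 0 t T Ht).
  - pose proof (RInt_power_nonneg phi t T T P HP Hphi ltac:(lra) ltac:(lra)). lra.
  - apply powers_on_ex_RInt. exact HP.
Qed.

Lemma RInt_power_pos (phi : R -> R) T P u :
  powers_on 0 T P -> (forall p, 0 <= p -> 0 <= phi p) -> 0 <= u < T ->
  0 < phi (P u) -> 0 < RInt (fun t => phi (P t)) 0 T.
Proof.
  intros HP Hphi Hu Hpos.
  destruct (powers_on_piece 0 T P u HP Hu) as [_ [v [Hv Hc]]].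
  pose proof (powers_on_ex_RInt phi 0 T P HP) as Hex.
  rewrite (RInt_split _ 0 v T ltac:(lra) Hex).
  rewrite (RInt_split _ 0 u v ltac:(lra)).
  - pose proof (RInt_power_nonneg phi 0 u T P HP Hphi ltac:(lra) ltac:(lra)).
    pose proof (RInt_power_nonneg phi v T T P HP Hphi ltac:(lra) ltac:(lra)).
    rewrite (RInt_eq_const (fun t => phi (P t)) (phi (P u)) u v).
    + nra.
    + lra.
    + intros t Ht. rewrite (Hc t Ht). reflexivity.
  - apply (ex_RInt_Chasles_1 (fun t => phi (P t)) 0 v T); [lra|exact Hex].
Qed.

(** Convertible to the integrand of [on_time], so that energy, bits and on-time are all integrals of
    some [phi (P t)] and share the same lemmas. *)
Definition is_on (p : R) : R := if Req_EM_T p 0 then 0 else 1.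

Lemma is_on_bounds p : 0 <= is_on p <= 1.
Proof. unfold is_on. destruct (Req_EM_T p 0); lra. Qed.

Lemma is_on_0 : is_on 0 = 0.
Proof. unfold is_on. destruct (Req_EM_T 0 0); lra. Qed.

Lemma RInt_power_extend (phi : R -> R) (Q : R -> R) t u p :
  powers_on 0 t Q -> t <= u -> (forall w, t <= w < u -> Q w = p) ->
  RInt (fun w => phi (Q w)) 0 u
    = RInt (fun w => phi (Q w)) 0 t + phi p * (u - t).
Proof.
  intros HQ Htu Hp.
  assert (Hc : forall w, t <= w < u -> phi (Q w) = phi p)
    by (intros w Hw; rewrite (Hp w Hw); reflexivity).
  rewrite <- (RInt_eq_const _ (phi p) t u Htu Hc). symmetry.
  apply (RInt_Chasles (V := R_CompleteNormedModule)).
  - apply powers_on_ex_RInt. exact HQ.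
  - apply ex_RInt_eq_const with (phi p); assumption.
Qed.

Lemma RInt_power_off (phi : R -> R) (Q : R -> R) t :
  0 <= t -> phi 0 = 0 -> (forall w, 0 <= w < t -> Q w = 0) ->
  RInt (fun w => phi (Q w)) 0 t = 0.
Proof.
  intros Ht Hphi HQ. apply eq_trans with (2 := Rmult_0_l (t - 0)).
  apply RInt_eq_const; [exact Ht|]. intros w Hw. rewrite HQ; assumption.
Qed.

Lemma on_time_step P a T :
  powers_on 0 T P -> 0 <= a <= T -> on_time P T <= on_time P a + (T - a).
Proof.
  intros HP Ha.
  pose proof (powers_on_ex_RInt is_on 0 T P HP) as Hex.
  pose proof (RInt_split _ 0 a T Ha Hex) as E.
  change (on_time P T = on_time P a + RInt (fun t => is_on (P t)) a T) in E.
  assert (E1 : RInt (fun _ => 1) a T = 1 * (T - a))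
    by (apply RInt_eq_const; [lra|reflexivity]).
  assert (RInt (fun t => is_on (P t)) a T <= RInt (fun _ => 1) a T).
  { apply RInt_le; [lra| |apply ex_RInt_const|].
    - exact (ex_RInt_Chasles_2 _ 0 a T Ha Hex).
    - intros t _. apply is_on_bounds. }
  lra.
Qed.

Lemma idle g P t :
  rate_function g -> 0 <= t -> (forall w, 0 <= w < t -> P w = 0) ->
  powers_on 0 t P /\ energy_used P t = 0 /\ bits_sent g P t = 0 /\ on_time P t = 0.
Proof.
  intros hg Ht H0. split; [|split; [|split]].
  - apply powers_on_const with 0; [exact Ht|lra|exact H0].
  - exact (RInt_power_off (fun p => p) P t Ht eq_refl H0).
  - exact (RInt_power_off g P t Ht (rate_0 _ hg) H0).
  - exact (RInt_power_off is_on P t Ht is_on_0 H0).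
Qed.

(* The rate lost, at power [p], with respect to the line [c + m p]; no loss
   when the transmitter is off. *)
Definition loss (g : R -> R) (c m p : R) : R := c * is_on p + m * p - g p.

Lemma loss_nonneg g c m x p :
  rate_function g -> supporting g c m x -> 0 <= p -> 0 <= loss g c m p.
Proof.
  intros hg [_ [_ [_ Hl]]] Hp. unfold loss, is_on.
  destruct (Req_EM_T p 0) as [->|].
  - rewrite (rate_0 _ hg). lra.
  - specialize (Hl p Hp). lra.
Qed.

Lemma RInt_power_linear (phi psi : R -> R) c m T P :
  powers_on 0 T P ->
  RInt (fun t => c * phi (P t) + m * psi (P t)) 0 T =
    c * RInt (fun t => phi (P t)) 0 T + m * RInt (fun t => psi (P t)) 0 T.
Proof.
  intros HP.
  pose proof (RInt_correct _ _ _ (powers_on_ex_RInt phi 0 T P HP)) as H1.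
  pose proof (RInt_correct _ _ _ (powers_on_ex_RInt psi 0 T P HP)) as H2.
  apply is_RInt_unique.
  exact (is_RInt_plus _ _ _ _ _ _ (is_RInt_scal _ _ _ c _ H1)
    (is_RInt_scal _ _ _ m _ H2)).
Qed.

Lemma bits_loss g c m T P :
  powers_on 0 T P ->
  bits_sent g P T =
    c * on_time P T + m * energy_used P T - RInt (fun t => loss g c m (P t)) 0 T.
Proof.
  intros HP.
  assert (E1 : RInt (fun t => loss g c m (P t)) 0 T =
    1 * RInt (fun t => c * is_on (P t) + m * P t) 0 T + -1 * bits_sent g P T).
  { unfold bits_sent. rewrite <- (RInt_power_linear
      (fun p => c * is_on p + m * p) g 1 (-1) T P HP).
    apply RInt_ext. intros t _. unfold loss. simpl. ring. }
  pose proof (RInt_power_linear is_on (fun p => p) c m T P HP) as E2.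
  change (RInt (fun t => c * is_on (P t) + m * P t) 0 T
    = c * on_time P T + m * energy_used P T) in E2.
  rewrite E1, E2. ring.
Qed.

(** * Duality bounds on the bits sent *)

Section Bounds.

Variables (g : R -> R) (c m x D T : R) (P : R -> R).
Hypothesis hg : rate_function g.
Hypothesis Hsup : supporting g c m x.
Hypothesis HP : powers_on 0 T P.
Hypothesis HT : 0 <= T.
Hypothesis HE : energy_used P T <= D * x.

(** At prices [c] and [m], on-time [D] and energy [D * x] are worth exactly [D * g x] bits, and the
    loss is nonnegative. *)
Lemma bits_bound : on_time P T <= D -> bits_sent g P T <= D * g x.
Proof.
  intros HC. rewrite (bits_loss g c m T P HP).
  pose proof (RInt_power_nonneg (loss g c m) 0 T T P HP
    (fun p => loss_nonneg g c m x p hg Hsup) ltac:(lra) ltac:(lra)).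
  destruct Hsup as [Hc [Hm [E _]]]. rewrite E. nra.
Qed.

Lemma bits_bound_strict u :
  on_time P T <= D -> 0 <= u < T -> 0 < loss g c m (P u) ->
  bits_sent g P T < D * g x.
Proof.
  intros HC Hu Hloss. rewrite (bits_loss g c m T P HP).
  pose proof (RInt_power_pos (loss g c m) T P u HP
    (fun p => loss_nonneg g c m x p hg Hsup) Hu Hloss).
  destruct Hsup as [Hc [Hm [E _]]]. rewrite E. nra.
Qed.

(** The energy pays for at most [m * (D * x)] of the [D * g x] bits; on-time at price [c] must pay
    for the remaining [c * D]. *)
Lemma on_time_ge : D * g x <= bits_sent g P T -> D <= on_time P T.
Proof.
  intros HB. rewrite (bits_loss g c m T P HP) in HB.
  pose proof (RInt_power_nonneg (loss g c m) 0 T T P HP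
    (fun p => loss_nonneg g c m x p hg Hsup) ltac:(lra) ltac:(lra)).
  destruct Hsup as [Hc [Hm [E _]]]. rewrite E in HB. nra.
Qed.

(* Reaching [D g x] bits forces the loss to vanish and all the energy to be
   used in time [D]; at a last contact point no power exceeds [x], hence no
   power falls below it either. *)
Lemma exposed_bits_bound u :
  (forall p, x < p -> g p < c + m * p) -> 0 < x ->
  on_time P T <= D -> 0 <= u < T -> P u <> 0 -> P u <> x ->
  bits_sent g P T < D * g x.
Proof.
  intros Hexp Hx HC Hu H0 Hne.
  destruct (Rlt_or_le (bits_sent g P T) (D * g x)) as [L|L]; [exact L|exfalso].
  assert (Hle : forall t, 0 <= t < T -> P t <> 0 -> P t <= x).
  { intros t Ht Hne0. destruct (Rle_or_lt (P t) x) as [L'|L']; [exact L'|].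
    assert (0 < loss g c m (P t)).
    { unfold loss, is_on. destruct (Req_EM_T (P t) 0); [lra|].
      specialize (Hexp _ L'). lra. }
    pose proof (bits_bound_strict t HC Ht H). lra. }
  pose proof (on_time_ge L) as HC'.
  (* [Rmax] makes [phi] nonnegative at every power, as [RInt_power_pos] requires. Along [P] it
     equals the linear expression, so a power strictly between 0 and [x] leaves the energy used
     below [x] times the on-time. *)
  pose (phi := fun p => Rmax 0 (x * is_on p - p)).
  assert (Hphi : forall p, 0 <= p -> 0 <= phi p) by (intros; apply Rmax_l).
  assert (Hpos : 0 < phi (P u)).
  { unfold phi, is_on. destruct (Req_EM_T (P u) 0); [lra|].
    pose proof (Hle u Hu H0). rewrite Rmax_right; lra. }
  pose proof (RInt_power_pos phi T P u HP Hphi Hu Hpos) as HI.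
  assert (E : RInt (fun t => phi (P t)) 0 T
    = x * on_time P T + -1 * energy_used P T).
  { apply eq_trans with (2 := RInt_power_linear is_on (fun p => p) x (-1) T P HP).
    apply RInt_ext. intros t. rewrite Rmin_left, Rmax_right by exact HT.
    intros Ht. unfold phi, is_on. rewrite Rmax_right; [simpl; ring|].
    destruct (Req_EM_T (P t) 0); [lra|]. pose proof (Hle t ltac:(lra) n). lra. }
  assert (HE' : x * D <= energy_used P T).
  { rewrite (bits_loss g c m T P HP) in L.
    pose proof (RInt_power_nonneg (loss g c m) 0 T T P HP
      (fun p => loss_nonneg g c m x p hg Hsup) ltac:(lra) ltac:(lra)).
    destruct Hsup as [Hc [Hm [Ex _]]]. rewrite Ex in L. nra. }
  nra.
Qed.

End Bounds.

(** * Arrival sequences *)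

Definition arrived (a : arrivals) (t : R) (i : nat) : R :=
  match a i with
  | Some (u, x) => if Rle_dec u t then x else 0
  | None => 0
  end.

Lemma Series_eventually_0 (f : nat -> R) n :
  (forall i, (n < i)%nat -> f i = 0) -> Series f = sum_f_R0 f n.
Proof.
  intros Hf. apply is_series_unique. rewrite <- sum_n_Reals.
  apply (filterlim_ext_loc (fun _ => sum_n f n)).
  - exists n. intros N HN. induction HN as [|N HN IH]; [reflexivity|].
    rewrite sum_Sn, <- IH, (Hf (S N)) by lia. symmetry. apply Rplus_0_r.
  - apply filterlim_const.
Qed.

Lemma total_finite a T :
  exists n, forall t, t <= T -> total a t = sum_f_R0 (arrived a t) n.
Proof.
  destruct (arrival_locally_finite a T) as [n Hn]. exists n. intros t Ht.
  apply Series_eventually_0. intros i Hi.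
  destruct (a i) as [[u x]|] eqn:E; [|reflexivity].
  pose proof (Hn i u x ltac:(lia) E). destruct (Rle_dec u t); lra.
Qed.

Lemma arrived_nonneg a t i : 0 <= arrived a t i.
Proof.
  unfold arrived. destruct (a i) as [[u x]|] eqn:E; [|lra].
  pose proof (arrival_positive a i u x E). destruct (Rle_dec u t); lra.
Qed.

Lemma total_mono a t t' : t <= t' -> total a t <= total a t'.
Proof.
  intros Ht. destruct (total_finite a t') as [n Hn].
  rewrite (Hn t Ht), (Hn t' (Rle_refl _)). apply sum_Rle. intros i _.
  unfold arrived. destruct (a i) as [[u x]|] eqn:E; [|lra].
  pose proof (arrival_positive a i u x E).
  destruct (Rle_dec u t); destruct (Rle_dec u t'); lra.
Qed.

Lemma total_pos a t : 0 <= t -> 0 < total a t.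
Proof.
  intros Ht. destruct (total_finite a t) as [n Hn]. rewrite (Hn t (Rle_refl _)).
  destruct (arrival_first a) as [x Hx].
  apply Rlt_le_trans with (arrived a t 0%nat).
  - unfold arrived. rewrite Hx. pose proof (arrival_positive a _ _ _ Hx).
    destruct (Rle_dec 0 t); lra.
  - clear Hn. induction n as [|n IH]; simpl; [lra|].
    pose proof (arrived_nonneg a t (S n)). lra.
Qed.

Lemma total_no_arrival (a : arrivals) t u :
  t <= u -> (forall i v x, a i = Some (v, x) -> t < v -> u < v) ->
  total a u = total a t.
Proof.
  intros Htu Hno. apply Series_ext. intros i.
  destruct (a i) as [[v x]|] eqn:E; [|reflexivity].
  pose proof (Hno i v x E). destruct (Rle_dec v t); destruct (Rle_dec v u); lra.
Qed.

Lemma arrival_instants (a : arrivals) j : forall i t x t' x',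
  (i < j)%nat -> a i = Some (t, x) -> a j = Some (t', x') -> t < t'.
Proof.
  induction j as [|j IH]; intros i t x t' x' Hij Hi Hj; [lia|].
  destruct (arrival_increasing a j t' x' Hj) as [u [y [Hu Hlt]]].
  destruct (Nat.eq_dec i j) as [->|Hne].
  - rewrite Hu in Hi. injection Hi as -> _. exact Hlt.
  - apply Rlt_trans with u; [|exact Hlt]. apply (IH i t x u y); auto. lia.
Qed.

(** Instants increase with the index, so the least index with an instant after [t] attains the
    infimum. *)
Lemma next_arrival_cases (a : arrivals) t :
  (next_arrival a t = p_infty /\ forall i v x, a i = Some (v, x) -> v <= t) \/
  (exists i v x, next_arrival a t = Finite v /\ a i = Some (v, x) /\ t < v /\
     forall j w y, a j = Some (w, y) -> t < w -> v <= w /\ (i <= j)%nat).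
Proof.
  pose (Q := fun i => exists v x, a i = Some (v, x) /\ t < v).
  destruct (Glb_Rbar_correct (fun u => t < u /\ exists i x, a i = Some (u, x)))
    as [Hlb Hglb].
  fold (next_arrival a t) in Hlb, Hglb.
  destruct (classic (exists i, Q i)) as [Hex|Hno].
  - right.
    destruct (Wf_nat.dec_inh_nat_subset_has_unique_least_element Q
      (fun i => classic (Q i)) Hex) as [i [[[v [x [Hi Hv]]] Hmin] _]].
    assert (H : forall j w y, a j = Some (w, y) -> t < w -> v <= w /\ (i <= j)%nat).
    { intros j w y Hj Hw.
      assert (Hij : (i <= j)%nat) by (apply Hmin; exists w, y; auto).
      split; [|exact Hij].
      destruct (Nat.eq_dec i j) as [<-|Hne].
      - rewrite Hi in Hj. injection Hj as <- _. lra.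
      - apply Rlt_le, (arrival_instants a j i v x w y); auto. lia. }
    exists i, v, x. repeat split; try assumption; try (eapply H; eassumption).
    apply Rbar_le_antisym.
    + apply Hlb. split; [exact Hv|]. exists i, x. exact Hi.
    + apply Hglb. intros w [Hw [j [y Hj]]]. apply (H j w y Hj Hw).
  - left.
    assert (H : forall i v x, a i = Some (v, x) -> v <= t).
    { intros i v x Hi. destruct (Rle_or_lt v t) as [L|L]; [exact L|].
      exfalso. apply Hno. exists i, v, x. auto. }
    split; [|exact H]. apply Rbar_le_antisym; [destruct (next_arrival a t); exact I|].
    apply Hglb. intros w [Hw [j [y Hj]]]. pose proof (H j w y Hj). lra.
Qed.

Lemma next_arrival_gt a (t : R) : Rbar_lt t (next_arrival a t).
Proof.
  destruct (next_arrival_cases a t) as [[-> _]|[i [v [x [-> [_ [Hv _]]]]]]].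
  - exact I.
  - exact Hv.
Qed.

Lemma next_arrival_le (a : arrivals) (t u : R) i x :
  a i = Some (u, x) -> t < u -> Rbar_le (next_arrival a t) u.
Proof.
  intros Hi Hu. apply (proj1 (Glb_Rbar_correct _)). split; [exact Hu|].
  exists i, x. exact Hi.
Qed.

Lemma total_before_next a (t u : R) :
  t <= u -> Rbar_lt u (next_arrival a t) -> total a u = total a t.
Proof.
  intros Htu Hu. apply total_no_arrival; [exact Htu|].
  intros i v x Hi Hv.
  pose proof (Rbar_lt_le_trans _ _ _ Hu (next_arrival_le a t v i x Hi Hv)).
  assumption.
Qed.

Lemma total_right_const a t :
  exists v, t < v /\ forall u, t <= u < v -> total a u = total a t.
Proof.
  pose proof (next_arrival_gt a t) as Hgt.
  destruct (next_arrival a t) as [v| |] eqn:E; [exists v|exists (t + 1)|easy].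
  - split; [exact Hgt|]. intros u Hu. apply total_before_next; [lra|].
    rewrite E. simpl. lra.
  - split; [lra|]. intros u Hu. apply total_before_next; [lra|].
    rewrite E. exact I.
Qed.

Lemma same_until_sym t a b : same_until t a b -> same_until t b a.
Proof. intros H i u x Hu. symmetry. apply H. exact Hu. Qed.

Lemma total_same t a b u : same_until t a b -> u <= t -> total a u = total b u.
Proof.
  intros H Hu. apply Series_ext. intros i.
  destruct (a i) as [[v x]|] eqn:Ea; destruct (b i) as [[w y]|] eqn:Eb;
    [| | |reflexivity].
  - destruct (Rle_dec v u) as [L|L].
    + apply (H i v x ltac:(lra)) in Ea. rewrite Ea in Eb.
      injection Eb as <- <-. destruct (Rle_dec v u); lra.
    + destruct (Rle_dec w u) as [L'|L']; [|reflexivity].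
      apply (H i w y ltac:(lra)) in Eb. rewrite Eb in Ea.
      injection Ea as <- <-. lra.
  - destruct (Rle_dec v u) as [L|L]; [|reflexivity].
    apply (H i v x ltac:(lra)) in Ea. congruence.
  - destruct (Rle_dec w u) as [L|L]; [|reflexivity].
    apply (H i w y ltac:(lra)) in Eb. congruence.
Qed.

(** Arrivals after [t] may differ between the two sequences, so only comparisons of [next_arrival]
    with an instant [u <= t] carry over. *)
Lemma next_arrival_same_lt t a b s (u : R) :
  same_until t a b -> u <= t ->
  Rbar_lt u (next_arrival a s) -> Rbar_lt u (next_arrival b s).
Proof.
  intros H Hu Hlt.
  destruct (next_arrival_cases b s) as [[-> _]|[i [v [x [-> [Hi [Hv _]]]]]]];
    [exact I|].
  destruct (Rlt_or_le u v) as [L|L]; [exact L|].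
  apply (H i v x ltac:(lra)) in Hi.
  pose proof (Rbar_lt_le_trans _ _ _ Hlt (next_arrival_le a s v i x Hi Hv)).
  assumption.
Qed.

Lemma next_arrival_same t a b s u :
  same_until t a b -> u <= t -> next_arrival a s = Finite u ->
  next_arrival b s = Finite u.
Proof.
  intros H Hu Ha.
  destruct (next_arrival_cases a s) as [[Ha' _]|[i [v [x [Ha' [Hi [Hv Hmin]]]]]]];
    rewrite Ha in Ha'; [discriminate|injection Ha' as <-].
  apply Rbar_le_antisym.
  - apply (next_arrival_le b s u i x); [|exact Hv]. apply H; assumption.
  - destruct (next_arrival_cases b s) as [[-> _]|[j [w [y [-> [Hj [Hw _]]]]]]];
      [exact I|].
    destruct (Rle_or_lt u w) as [L|L]; [exact L|].
    apply (H j w y ltac:(lra)) in Hj. apply (Hmin j w y Hj Hw).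
Qed.

(** The entries are exposed besides the totals because causality compares inputs arrival by
    arrival. *)
Lemma one_arrival x0 :
  0 < x0 -> exists a : arrivals,
    (forall i, a i = match i with O => Some (0, x0) | _ => None end) /\
    (forall t, 0 <= t -> total a t = x0).
Proof.
  intros Hx.
  pose (s := fun i : nat => match i with O => Some (0, x0) | _ => None end).
  assert (H1 : exists x, s 0%nat = Some (0, x)) by (exists x0; reflexivity).
  assert (H2 : forall i t' x', s (S i) = Some (t', x') ->
    exists t x, s i = Some (t, x) /\ t < t') by discriminate.
  assert (H3 : forall i t x, s i = Some (t, x) -> 0 < x).
  { intros [|i] t x; [|discriminate]. intros E. injection E as <- <-. exact Hx. }
  assert (H4 : forall T, exists n, forall i t x,
    (n <= i)%nat -> s i = Some (t, x) -> T < t).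
  { intros T. exists 1%nat. intros [|i] t x Hi; [lia|discriminate]. }
  exists (Build_arrivals s H1 H2 H3 H4). split; [reflexivity|].
  intros t Ht. unfold total. rewrite (Series_eventually_0 _ 0%nat).
  - simpl. destruct (Rle_dec 0 t); lra.
  - intros [|i] Hi; [lia|reflexivity].
Qed.

Lemma two_arrivals x0 t1 x1 :
  0 < x0 -> 0 < t1 -> 0 < x1 -> exists a : arrivals,
    (forall i, a i = match i with
                     | O => Some (0, x0) | S O => Some (t1, x1) | _ => None
                     end) /\
    (forall t, 0 <= t < t1 -> total a t = x0) /\
    (forall t, t1 <= t -> total a t = x0 + x1).
Proof.
  intros Hx0 Ht1 Hx1.
  pose (s := fun i : nat => match i with
                     | O => Some (0, x0) | S O => Some (t1, x1) | _ => None
                     end).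
  assert (H1 : exists x, s 0%nat = Some (0, x)) by (exists x0; reflexivity).
  assert (H2 : forall i t' x', s (S i) = Some (t', x') ->
    exists t x, s i = Some (t, x) /\ t < t').
  { intros [|i] t' x'; [|discriminate]. intros E. injection E as <- <-.
    exists 0, x0. auto. }
  assert (H3 : forall i t x, s i = Some (t, x) -> 0 < x).
  { intros [|[|i]] t x; [| |discriminate]; intros E; injection E as <- <-;
      assumption. }
  assert (H4 : forall T, exists n, forall i t x,
    (n <= i)%nat -> s i = Some (t, x) -> T < t).
  { intros T. exists 2%nat. intros [|[|i]] t x Hi; [lia|lia|discriminate]. }
  assert (Htot : forall t, total (Build_arrivals s H1 H2 H3 H4) t
    = (if Rle_dec 0 t then x0 else 0) + (if Rle_dec t1 t then x1 else 0)).
  { intros t. unfold total. rewrite (Series_eventually_0 _ 1%nat); [reflexivity|].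
    intros [|[|i]] Hi; [lia|lia|reflexivity]. }
  exists (Build_arrivals s H1 H2 H3 H4). split; [reflexivity|].
  split; intros t Ht; rewrite Htot; destruct (Rle_dec 0 t);
    destruct (Rle_dec t1 t); lra.
Qed.

(** * The algorithm ON *)

Section ON_run.

Variables (g : R -> R) (B0 : R).
Hypothesis hg : rate_function g.
Hypothesis hB0 : 0 < B0.

(** [ratio_surj] shows that the choice in [exhausting_power] has a solution to pick, and supplies
    one that is at least [l0]; injectivity of the ratio identifies it with the chosen one. *)
Lemma exhausting_power_spec e b l0 :
  0 < e -> 0 < b -> 0 < l0 -> b / e <= g l0 / l0 ->
  l0 <= exhausting_power g e b /\
  g (exhausting_power g e b) / exhausting_power g e b * e = b.
Proof.
  intros He Hb Hl0 Hr.
  assert (Hbe : 0 < b / e) by (apply Rdiv_lt_0_compat; assumption).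
  destruct (ratio_surj g hg (b / e) l0 Hl0 (conj Hbe Hr)) as [l [Hl Hgl]].
  assert (Hex : exists l, 0 < l /\ e / l * g l = b).
  { exists l. split; [lra|].
    replace (e / l * g l) with (g l / l * e) by (field; lra).
    rewrite Hgl. field. lra. }
  destruct (epsilon_spec (inhabits 0) _ Hex) as [Hpos Heq].
  fold (exhausting_power g e b) in Hpos, Heq.
  revert Hpos Heq. generalize (exhausting_power g e b). intros k Hpos Heq.
  assert (E : g k / k * e = b) by (rewrite <- Heq; field; lra).
  split; [|exact E].
  replace k with l; [exact Hl|]. apply (ratio_inj g hg); [lra|exact Hpos|].
  rewrite Hgl, <- E. field. lra.
Qed.

Section Input.

Variables sigma rho : arrivals.

Notation enough t := (B0 <= total rho t * g (total sigma t / total rho t)).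
Notation phase := (ON_phase g B0 sigma rho).
Notation P := (ON_power g B0 sigma rho).
Notation power := (exhausting_power g).
Notation completion t e b := (t + b / g (power e b)).

Lemma T_start_cases :
  (T_start g B0 sigma rho = p_infty /\ forall t, 0 <= t -> ~ enough t) \/
  (exists x, T_start g B0 sigma rho = Finite x /\ 0 <= x /\ enough x /\
    forall t, 0 <= t < x -> ~ enough t).
Proof.
  destruct (Glb_Rbar_correct (fun t => 0 <= t /\ enough t)) as [Hlb Hglb].
  fold (T_start g B0 sigma rho) in Hlb, Hglb.
  destruct (classic (exists t, 0 <= t /\ enough t)) as [[t0 [Ht0 Hen0]]|Hno].
  - right. pose proof (Hlb t0 (conj Ht0 Hen0)) as H0.
    assert (Hpos : Rbar_le 0 (T_start g B0 sigma rho)).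
    { apply Hglb. intros x [Hx _]. exact Hx. }
    destruct (T_start g B0 sigma rho) as [x| |]; try contradiction.
    exists x. split; [reflexivity|]. split; [exact Hpos|].
    assert (Hbefore : forall t, 0 <= t < x -> ~ enough t).
    { intros t Ht Hen. pose proof (Hlb t (conj (proj1 Ht) Hen)) as H.
      simpl in H. lra. }
    split; [|exact Hbefore].
    destruct (total_right_const sigma x) as [v [Hv Hs]].
    destruct (total_right_const rho x) as [w [Hw Hr]].
    (* Both totals are constant just to the right of the infimum [x], so an admissible instant there
       certifies [x] itself; without one, [Rmin v w] would be a larger lower bound. *)
    destruct (classic (exists t, x <= t < Rmin v w /\ enough t))
      as [[t [Ht Hen]]|Hnone].
    + pose proof (Rmin_l v w). pose proof (Rmin_r v w).
      rewrite (Hs t ltac:(lra)), (Hr t ltac:(lra)) in Hen. exact Hen.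
    + exfalso. assert (H : Rbar_le (Rmin v w) x).
      { apply Hglb. intros t [Ht Hen]. simpl.
        destruct (Rle_or_lt (Rmin v w) t) as [L|L]; [exact L|exfalso].
        apply Hnone. exists t. split; [|exact Hen]. split; [|exact L].
        exact (Hlb t (conj Ht Hen)). }
      simpl in H. pose proof (Rmin_glb_lt v w x Hv Hw). lra.
  - left. split.
    + apply Rbar_le_antisym; [destruct (T_start g B0 sigma rho); exact I|].
      apply Hglb. intros x Hx. exfalso. apply Hno. exists x. exact Hx.
    + intros t Ht Hen. apply Hno. exists t. auto.
Qed.

Lemma phase_0 t e b :
  phase 0 = Some (t, e, b) <->
  T_start g B0 sigma rho = Finite t /\ e = total sigma t /\ b = B0.
Proof.
  simpl. destruct (T_start g B0 sigma rho) as [x| |].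
  - split.
    + intros E. injection E as <- <- <-. auto.
    + intros [E [-> ->]]. injection E as ->. reflexivity.
  - split; [discriminate|intros [E _]; discriminate].
  - split; [discriminate|intros [E _]; discriminate].
Qed.

Lemma phase_S m t' e' b' :
  phase (S m) = Some (t', e', b') <->
  exists t e b, phase m = Some (t, e, b) /\
    next_arrival sigma t = Finite t' /\ t' < completion t e b /\
    e' = e - power e b * (t' - t) + (total sigma t' - total sigma t) /\
    b' = b - g (power e b) * (t' - t).
Proof.
  simpl. destruct (phase m) as [[[t e] b]|].
  - split.
    + destruct (next_arrival sigma t) as [u| |] eqn:En; try discriminate.
      destruct (Rlt_dec u (completion t e b)) as [L|L]; [|discriminate].
      intros E. injection E as <- <- <-. exists t, e, b. auto.
    + intros [t0 [e0 [b0 [E [En [L [-> ->]]]]]]]. injection E as <- <- <-.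
      rewrite En. destruct (Rlt_dec t' (completion t e b)); [reflexivity|contradiction].
  - split; [discriminate|]. intros [t0 [e0 [b0 [E _]]]]. discriminate.
Qed.

Lemma phase_later m n t e b t' e' b' :
  (m < n)%nat -> phase m = Some (t, e, b) -> phase n = Some (t', e', b') ->
  Rbar_le (next_arrival sigma t) t'.
Proof.
  intros Hmn Hm. revert t' e' b'. induction Hmn as [|n Hmn IH]; intros t' e' b' Hn.
  - apply phase_S in Hn as [t0 [e0 [b0 [E [En _]]]]].
    rewrite Hm in E. injection E as <- <- <-. rewrite En. apply Rbar_le_refl.
  - apply phase_S in Hn as [t0 [e0 [b0 [E [En _]]]]].
    apply Rbar_le_trans with t0; [exact (IH _ _ _ E)|].
    apply Rbar_lt_le. rewrite <- En. apply next_arrival_gt.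
Qed.

Lemma phase_pred m n t' e' b' :
  (m <= n)%nat -> phase n = Some (t', e', b') ->
  exists t e b, phase m = Some (t, e, b).
Proof.
  intros Hmn. revert t' e' b'. induction Hmn as [|n Hmn IH]; intros t' e' b' Hn.
  - eauto.
  - apply phase_S in Hn as [t0 [e0 [b0 [E _]]]]. eauto.
Qed.

(** Distinct phases occupy disjoint intervals, each ending by the next arrival, so the phase
    containing [u] is unique and the choice in [ON_power] is forced. *)
Lemma ON_transmits_phase m t e b u l :
  phase m = Some (t, e, b) -> t <= u -> Rbar_lt u (next_arrival sigma t) ->
  ON_transmits g B0 sigma rho u l -> l = power e b /\ u < completion t e b.
Proof.
  intros Hm Htu Hu [n [t' [e' [b' [Hn [-> [Ht' Hu']]]]]]].
  destruct (Nat.lt_trichotomy m n) as [L|[<-|L]].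
  - pose proof (Rbar_lt_le_trans _ _ _ Hu (phase_later _ _ _ _ _ _ _ _ L Hm Hn)) as H.
    simpl in H. lra.
  - rewrite Hm in Hn. injection Hn as <- <- <-. split; [reflexivity|lra].
  - pose proof (Rbar_lt_le_trans _ _ _ Hu' (phase_later _ _ _ _ _ _ _ _ L Hn Hm)) as H.
    simpl in H. lra.
Qed.

Lemma ON_power_eq u l : ON_transmits g B0 sigma rho u l -> P u = l.
Proof.
  intros H. unfold ON_power.
  destruct (excluded_middle_informative _) as [ex|nex].
  - destruct (constructive_indefinite_description _ ex) as [l' H']. simpl.
    destruct H as [m [t [e [b [Hm [-> [Ht Hu]]]]]]].
    apply (ON_transmits_phase m t e b u l'); [exact Hm|lra|exact Hu|exact H'].
  - exfalso. apply nex. exists l. exact H.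
Qed.

Lemma ON_power_off u : (forall l, ~ ON_transmits g B0 sigma rho u l) -> P u = 0.
Proof.
  intros H. unfold ON_power.
  destruct (excluded_middle_informative _) as [[l Hl]|nex]; [|reflexivity].
  exfalso. exact (H l Hl).
Qed.

Lemma ON_power_before u :
  (forall t, T_start g B0 sigma rho = Finite t -> u < t) -> P u = 0.
Proof.
  intros H. apply ON_power_off.
  intros l [m [t [e [b [Hm [_ [Ht _]]]]]]].
  destruct (phase_pred 0 m t e b ltac:(lia) Hm) as [t0 [e0 [b0 H0]]].
  pose proof (proj1 (phase_0 _ _ _) H0) as [Hts _].
  pose proof (H _ Hts) as Hlt. destruct m as [|m].
  - rewrite H0 in Hm. injection Hm as <- <- <-. lra.
  - pose proof (Rbar_lt_le_trans _ _ _ (next_arrival_gt sigma t0)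
      (phase_later 0 (S m) _ _ _ _ _ _ ltac:(lia) H0 Hm)) as H1.
    simpl in H1. lra.
Qed.

Lemma ON_power_phase m t e b u :
  phase m = Some (t, e, b) -> t <= u -> Rbar_lt u (next_arrival sigma t) ->
  P u = if Rlt_dec u (completion t e b) then power e b else 0.
Proof.
  intros Hm Ht Hu. destruct (Rlt_dec u (completion t e b)) as [L|L].
  - apply ON_power_eq. exists m, t, e, b. repeat split; auto.
  - apply ON_power_off. intros l Hl.
    pose proof (ON_transmits_phase m t e b u l Hm Ht Hu Hl). lra.
Qed.

(** A phase that completes by the next arrival has no successor, so the formula also holds after
    that arrival. *)
Lemma ON_power_last m t e b u :
  phase m = Some (t, e, b) -> Rbar_le (completion t e b) (next_arrival sigma t) ->
  t <= u -> P u = if Rlt_dec u (completion t e b) then power e b else 0.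
Proof.
  intros Hm Hlast Ht.
  destruct (Rlt_dec u (completion t e b)) as [L|L].
  - apply ON_power_eq. exists m, t, e, b. repeat split; auto.
    apply Rbar_lt_le_trans with (2 := Hlast). exact L.
  - apply ON_power_off. intros l [n [t' [e' [b' [Hn [-> [Ht' Hu']]]]]]].
    destruct (Nat.lt_trichotomy m n) as [C|[<-|C]].
    + destruct (phase_pred (S m) n _ _ _ C Hn) as [t1 [e1 [b1 H1]]].
      apply phase_S in H1 as [t0 [e0 [b0 [E [En [Hc _]]]]]].
      rewrite Hm in E. injection E as <- <- <-. rewrite En in Hlast.
      simpl in Hlast. lra.
    + rewrite Hm in Hn. injection Hn as <- <- <-. lra.
    + pose proof (Rbar_lt_le_trans _ _ _ Hu' (phase_later _ _ _ _ _ _ _ _ C Hn Hm)) as H.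
      simpl in H. lra.
Qed.

(** [inv_efficiency] bounds the bits that all energy received so far would carry at the current
    ratio: earlier energy was spent at ratios at least as good. By [inv_receiver], the on-time
    present at [ts] covers the run up to completion, whatever the receiver gets later. *)
Record phase_invariant (ts t e b : R) : Prop := {
  inv_start : 0 <= ts <= t;
  inv_energy_left : 0 < e;
  inv_bits_left : 0 < b;
  inv_power : 0 < power e b;
  inv_exhausts : g (power e b) / power e b * e = b;
  inv_efficiency : total sigma t * (g (power e b) / power e b) <= B0;
  inv_powers_on : powers_on 0 t P;
  inv_energy_used : energy_used P t = total sigma t - e;
  inv_bits_sent : bits_sent g P t = B0 - b;
  inv_on_time : on_time P t = t - ts;
  inv_receiver : completion t e b <= ts + total rho ts
}.

Lemma phase_duration e b :
  0 < e -> 0 < power e b -> g (power e b) / power e b * e = b ->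
  b / g (power e b) = e / power e b.
Proof.
  intros He Hl Hb. pose proof (rate_pos g hg _ Hl).
  set (l := power e b) in *. rewrite <- Hb. field. lra.
Qed.

(** An arrival adds energy and leaves the remaining bits unchanged, so the exhausting ratio falls
    and the power rises; the same bits are then finished no later. *)
Lemma phase_step ts m t e b t' e' b' :
  phase_invariant ts t e b -> phase m = Some (t, e, b) ->
  phase (S m) = Some (t', e', b') ->
  phase_invariant ts t' e' b' /\ t < t' /\ completion t' e' b' <= completion t e b.
Proof.
  intros [Hts He Hb Hl Hex Heff HP HE HB HC Hrx] Hm HS.
  apply phase_S in HS as [t0 [e0 [b0 [E [En [Hc [He' Hb']]]]]]].
  rewrite Hm in E. injection E as <- <- <-.
  pose proof (next_arrival_gt sigma t) as Htt. rewrite En in Htt. simpl in Htt.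
  pose proof (phase_duration e b He Hl Hex) as Hdur.
  pose proof (total_mono sigma t t' ltac:(lra)) as Hmono.
  set (l := power e b) in *.
  pose proof (rate_pos g hg l Hl) as Hgl.
  assert (Hdl : e / l * l = e) by (field; lra).
  assert (Hdg : b / g l * g l = b) by (field; lra).
  assert (Hel : 0 < e - l * (t' - t)) by (rewrite Hdur in Hc; nra).
  assert (He'0 : 0 < e') by lra.
  assert (Hb'0 : 0 < b') by nra.
  (* Without the new energy, [l] would remain the exhausting power; the new energy can only lower
     [b' / e']. *)
  assert (Hr : b' = g l / l * (e - l * (t' - t))).
  { rewrite Hb', <- Hex. field. lra. }
  assert (Hrl : 0 < g l / l) by (apply Rdiv_lt_0_compat; assumption).
  assert (Hle : b' / e' <= g l / l) by (apply Rle_div_l; [lra|nra]).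
  destruct (exhausting_power_spec e' b' l He'0 Hb'0 Hl Hle) as [Hl' Hex'].
  set (l' := power e' b') in *.
  assert (Hgl' : g l <= g l') by (apply (rate_increasing _ hg); lra).
  assert (Hpow : forall w, t <= w < t' -> P w = l).
  { intros w Hw. rewrite (ON_power_phase m t e b w Hm (proj1 Hw)).
    - fold l. destruct (Rlt_dec w (t + b / g l)); lra.
    - rewrite En. simpl. lra. }
  assert (Hcomp : t' + b' / g l' <= t + b / g l).
  { assert (b' / g l' <= b' / g l).
    { apply Rmult_le_compat_l; [lra|]. apply Rinv_le_contravar; assumption. }
    assert (b' / g l = b / g l - (t' - t)) by (rewrite Hb'; field; lra). lra. }
  assert (Hratio : g l' / l' <= g l / l).
  { apply (rate_ratio_decreasing _ hg); assumption. }
  split; [|split; [lra|exact Hcomp]].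
  constructor; fold l'; try assumption; try lra.
  - (* the [B0 - b'] bits sent so far were sent at ratio at least [g l / l] *)
    pose proof (RInt_power_nonneg (fun p => p) 0 t t P HP (fun p Hp => Hp)
      ltac:(lra) ltac:(lra)) as HU.
    change (0 <= energy_used P t) in HU.
    assert (Hused : total sigma t' - e' = total sigma t - e + l * (t' - t)) by lra.
    assert (HU' : 0 <= total sigma t' - e') by nra.
    assert (Hlr : g l / l * l = g l) by (field; lra).
    assert (Hsent : (total sigma t' - e') * (g l / l) <= B0 - b').
    { rewrite Hused, Hb'. nra. }
    nra.
  - apply powers_on_extend with t l; try assumption; lra.
  - transitivity (energy_used P t + l * (t' - t)).
    + exact (RInt_power_extend (fun p => p) P t t' l HP (Rlt_le _ _ Htt) Hpow).
    + lra.
  - transitivity (bits_sent g P t + g l * (t' - t)).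
    + exact (RInt_power_extend g P t t' l HP (Rlt_le _ _ Htt) Hpow).
    + lra.
  - transitivity (on_time P t + is_on l * (t' - t)).
    + exact (RInt_power_extend is_on P t t' l HP (Rlt_le _ _ Htt) Hpow).
    + unfold is_on. destruct (Req_EM_T l 0); lra.
Qed.

Lemma phase_invariant_0 ts e b :
  phase 0 = Some (ts, e, b) -> phase_invariant ts ts e b.
Proof.
  intros H0. apply phase_0 in H0 as [Hts [-> ->]].
  destruct T_start_cases as [[E _]|[x [E [Hx [Hen _]]]]];
    rewrite Hts in E; [discriminate|injection E as <-].
  pose proof (total_pos sigma ts Hx) as HE. pose proof (total_pos rho ts Hx) as HG.
  set (E := total sigma ts) in *. set (G := total rho ts) in *.
  assert (HEG : 0 < E / G) by (apply Rdiv_lt_0_compat; assumption).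
  (* The starting condition says that power [E / G] sends at least [B0] bits in on-time [G]; hence
     the exhausting power is at least [E / G] and lasts at most [G]. *)
  assert (Hle : B0 / E <= g (E / G) / (E / G)).
  { apply Rle_div_l; [exact HE|].
    replace (g (E / G) / (E / G) * E) with (G * g (E / G)) by (field; lra).
    exact Hen. }
  destruct (exhausting_power_spec E B0 (E / G) HE hB0 HEG Hle) as [Hl Hex].
  assert (Hpos : 0 < power E B0) by lra.
  destruct (idle g P ts hg Hx) as [Hp [Hu [Hb Hc]]].
  { intros w Hw. apply ON_power_before. intros t Ht. rewrite Hts in Ht.
    injection Ht as <-. lra. }
  constructor; try assumption; fold E; try lra.
  rewrite (phase_duration E B0 HE Hpos Hex). fold G.
  assert (E / power E B0 <= G); [|lra].
  apply Rle_div_l; [exact Hpos|]. apply Rle_div_l in Hl; [|exact HG]. lra.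
Qed.

Lemma phase_invariant_all ts e0 m t e b :
  phase 0 = Some (ts, e0, B0) -> phase m = Some (t, e, b) ->
  phase_invariant ts t e b.
Proof.
  intros H0. revert t e b. induction m as [|m IH]; intros t e b Hm.
  - rewrite H0 in Hm. injection Hm as <- <- <-. apply phase_invariant_0. exact H0.
  - destruct (phase_pred m (S m) t e b ltac:(lia) Hm) as [t0 [e1 [b1 E]]].
    exact (proj1 (phase_step ts m t0 e1 b1 t e b (IH _ _ _ E) E Hm)).
Qed.

Lemma completion_mono ts e0 m n t e b t' e' b' :
  phase 0 = Some (ts, e0, B0) -> (m <= n)%nat ->
  phase m = Some (t, e, b) -> phase n = Some (t', e', b') ->
  t <= t' /\ completion t' e' b' <= completion t e b.
Proof.
  intros H0 Hmn Hm. revert t' e' b'.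
  induction Hmn as [|n Hmn IH]; intros t' e' b' Hn.
  - rewrite Hm in Hn. injection Hn as <- <- <-. lra.
  - destruct (phase_pred n (S n) t' e' b' ltac:(lia) Hn) as [t1 [e1 [b1 E]]].
    pose proof (IH _ _ _ E).
    pose proof (phase_step ts n t1 e1 b1 t' e' b'
      (phase_invariant_all ts e0 n _ _ _ H0 E) E Hn). lra.
Qed.

(** Each phase after the first starts at a later arrival; the index bound lets local finiteness
    limit the number of phases. *)
Lemma phase_arrival m t e b :
  phase (S m) = Some (t, e, b) ->
  exists i x, (m <= i)%nat /\ sigma i = Some (t, x).
Proof.
  revert t e b. induction m as [|m IH]; intros t e b Hm;
    pose proof Hm as Hm'; apply phase_S in Hm as [t0 [e0 [b0 [H0 [En _]]]]];
    destruct (next_arrival_cases sigma t0)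
      as [[E _]|[i [v [x [E [Hi [Hv Hmin]]]]]]];
    rewrite En in E; try discriminate; injection E as <-.
  - exists i, x. split; [lia|exact Hi].
  - exists i, x. split; [|exact Hi].
    destruct (IH _ _ _ H0) as [j [y [Hj Hjt]]].
    destruct (Nat.lt_trichotomy i j) as [L|[->|L]]; [| |lia].
    + pose proof (arrival_instants sigma j i _ _ _ _ L Hi Hjt). lra.
    + rewrite Hi in Hjt. injection Hjt as Ht _. lra.
Qed.

(** Otherwise there would be infinitely many phases, all starting before the completion predicted by
    the first one, against local finiteness of the arrivals. *)
Lemma last_phase ts e0 :
  phase 0 = Some (ts, e0, B0) ->
  exists m t e b, phase m = Some (t, e, b) /\
    Rbar_le (completion t e b) (next_arrival sigma t).
Proof.
  intros H0. apply NNPP. intros Hno.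
  assert (Hall : forall m, exists t e b, phase m = Some (t, e, b)).
  { induction m as [|m [t [e [b IH]]]]; [eauto|].
    destruct (Rbar_lt_dec (next_arrival sigma t) (completion t e b)) as [L|L].
    - pose proof (next_arrival_gt sigma t) as Hgt.
      destruct (next_arrival sigma t) as [v| |] eqn:En; try contradiction.
      exists v. do 2 eexists. apply phase_S. exists t, e, b.
      repeat split; try assumption; reflexivity.
    - exfalso. apply Hno. exists m, t, e, b. split; [exact IH|].
      apply Rbar_not_lt_le. exact L. }
  destruct (arrival_locally_finite sigma (completion ts e0 B0)) as [n Hn].
  destruct (Hall (S n)) as [t [e [b Ht]]].
  destruct (phase_arrival n t e b Ht) as [i [x [Hi Hx]]].
  pose proof (Hn i t x Hi Hx).
  pose proof (completion_mono ts e0 0 (S n) _ _ _ _ _ _ H0 ltac:(lia) H0 Ht).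
  destruct (phase_invariant_all ts e0 (S n) _ _ _ H0 Ht).
  assert (0 < b / g (power e b)).
  { apply Rdiv_lt_0_compat; [assumption|]. apply (rate_pos g hg). assumption. }
  lra.
Qed.

(** Finds the phase that determines the power from its start up to [T]. In the second alternative
    the phase is final, and [T] may lie beyond its completion and beyond later arrivals. *)
Lemma phase_covering ts e0 (T : R) :
  phase 0 = Some (ts, e0, B0) -> ts <= T ->
  exists m t e b, phase m = Some (t, e, b) /\ t <= T /\
    (Rbar_lt T (next_arrival sigma t) \/
     Rbar_le (completion t e b) (next_arrival sigma t)).
Proof.
  intros H0 HT.
  destruct (last_phase ts e0 H0) as [M [t [e [b [HM Hlast]]]]].
  assert (H : forall n t e b, phase n = Some (t, e, b) -> T < t ->
    exists m t e b, phase m = Some (t, e, b) /\ t <= T /\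
      Rbar_lt T (next_arrival sigma t)).
  { induction n as [|n IH]; intros t1 e1 b1 Hn HTt.
    - rewrite H0 in Hn. injection Hn as <- <- <-. lra.
    - apply phase_S in Hn as [t2 [e2 [b2 [H2 [En _]]]]].
      destruct (Rle_or_lt t2 T) as [L|L].
      + exists n, t2, e2, b2. rewrite En. auto.
      + exact (IH _ _ _ H2 L). }
  destruct (Rle_or_lt t T) as [L|L].
  - exists M, t, e, b. auto.
  - destruct (H M t e b HM L) as [m [t' [e' [b' [Hm [Ht' Hlt]]]]]].
    exists m, t', e', b'. auto.
Qed.

Lemma ON_power_covering m t e b (T w : R) :
  phase m = Some (t, e, b) ->
  Rbar_lt T (next_arrival sigma t) \/
    Rbar_le (completion t e b) (next_arrival sigma t) ->
  t <= w <= T -> P w = if Rlt_dec w (completion t e b) then power e b else 0.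
Proof.
  intros Hm Hc Hw. destruct Hc as [Hc|Hc].
  - apply (ON_power_phase m); [exact Hm|lra|].
    apply Rbar_le_lt_trans with T; [exact (proj2 Hw)|exact Hc].
  - apply (ON_power_last m); [exact Hm|exact Hc|lra].
Qed.

Lemma RInt_power_phase (phi : R -> R) m t e b (T : R) :
  phi 0 = 0 -> powers_on 0 t P -> 0 < b / g (power e b) -> t <= T ->
  0 <= power e b ->
  phase m = Some (t, e, b) ->
  Rbar_lt T (next_arrival sigma t) \/
    Rbar_le (completion t e b) (next_arrival sigma t) ->
  powers_on 0 T P /\
  RInt (fun w => phi (P w)) 0 T = RInt (fun w => phi (P w)) 0 t
    + phi (power e b) * (Rmin T (completion t e b) - t).
Proof.
  intros Hphi HP Hd HT Hl Hm Hc.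
  set (l := power e b) in *. set (c := t + b / g l) in *.
  assert (Hc0 : t < c) by (unfold c; lra).
  pose proof (Rmin_l T c) as HminT. pose proof (Rmin_r T c) as Hminc.
  assert (Htmin : t <= Rmin T c) by (apply Rmin_glb; lra).
  assert (H1 : forall w, t <= w < Rmin T c -> P w = l).
  { intros w Hw. rewrite (ON_power_covering m t e b T w Hm Hc) by lra.
    fold l c. destruct (Rlt_dec w c); lra. }
  assert (H2 : forall w, Rmin T c <= w < T -> P w = 0).
  { intros w Hw. rewrite (ON_power_covering m t e b T w Hm Hc) by lra.
    fold l c. destruct (Rlt_dec w c) as [L|L]; [|reflexivity].
    pose proof (Rmin_glb_lt T c w (proj2 Hw) L). lra. }
  assert (HP1 : powers_on 0 (Rmin T c) P)
    by (apply powers_on_extend with t l; assumption).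
  split.
  - apply powers_on_extend with (Rmin T c) 0; try assumption. lra.
  - rewrite (RInt_power_extend phi P (Rmin T c) T 0 HP1 HminT H2).
    rewrite (RInt_power_extend phi P t (Rmin T c) l HP Htmin H1).
    rewrite Hphi. simpl. lra.
Qed.

Lemma ON_run_spec T :
  0 <= T -> powers_on 0 T P /\ respects sigma rho P T.
Proof.
  intros HT.
  pose proof (total_pos sigma T HT) as HE. pose proof (total_pos rho T HT) as HG.
  destruct (classic (exists ts, T_start g B0 sigma rho = Finite ts /\ ts <= T))
    as [[ts [Hts HtsT]]|Hno].
  - pose proof (proj2 (phase_0 _ _ _) (conj Hts (conj eq_refl eq_refl))) as H0.
    destruct (phase_covering ts _ T H0 HtsT) as [m [t [e [b [Hm [Ht Hc]]]]]].
    destruct (phase_invariant_all ts _ m t e b H0 Hm) as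
      [[Hts0 Htst] He Hb Hl Hex Heff HP HEu HBs HC Hrx].
    pose proof (phase_duration e b He Hl Hex) as Hdur.
    assert (Hd : 0 < b / g (power e b)).
    { rewrite Hdur. apply Rdiv_lt_0_compat; assumption. }
    pose proof (RInt_power_phase (fun p => p) m t e b T eq_refl HP Hd Ht
      (Rlt_le _ _ Hl) Hm Hc) as [HPT IE].
    pose proof (RInt_power_phase is_on m t e b T is_on_0 HP Hd Ht
      (Rlt_le _ _ Hl) Hm Hc) as [_ IC].
    change (energy_used P T = energy_used P t
      + power e b * (Rmin T (completion t e b) - t)) in IE.
    change (on_time P T = on_time P t
      + is_on (power e b) * (Rmin T (completion t e b) - t)) in IC.
    pose proof (Rmin_r T (completion t e b)) as Hmin.
    assert (Htmin : t <= Rmin T (completion t e b)) by (apply Rmin_glb; lra).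
    pose proof (total_mono sigma t T Ht). pose proof (total_mono rho ts T HtsT).
    split; [exact HPT|]. split.
    (* From [t] on the power runs for at most [e / power e b], hence spends at most the energy
       [e]. *)
    + rewrite IE, HEu.
      assert (power e b * (e / power e b) = e) by (field; lra).
      rewrite Hdur in *. nra.
    + rewrite IC, HC. pose proof (is_on_bounds (power e b)). nra.
  - destruct (idle g P T hg HT) as [HP [Hu [_ Hc]]].
    { intros w Hw. apply ON_power_before. intros t Ht.
      destruct (Rle_or_lt t T) as [L|L]; [|lra].
      exfalso. apply Hno. exists t. auto. }
    split; [exact HP|]. split; lra.
Qed.

(* If [T] time units and the energy arrived by [T] suffice for [B0] bits, the
   power in use at [T] exceeds [total sigma T / T], so that the energy left is
   exhausted within another [T] time units. *)
Lemma ON_finish ts T :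
  T_start g B0 sigma rho = Finite ts -> ts <= T -> 0 < T ->
  B0 <= T * g (total sigma T / T) ->
  exists c, 0 <= c <= 2 * T /\ B0 <= bits_sent g P c.
Proof.
  intros Hts HtsT HT HB.
  pose proof (proj2 (phase_0 _ _ _) (conj Hts (conj eq_refl eq_refl))) as H0.
  destruct (last_phase ts _ H0) as [M [tM [eM [bM [HM Hlast]]]]].
  destruct (phase_invariant_all ts _ M tM eM bM H0 HM) as
    [[Hts0 Htst] He Hb Hl Hex _ HP _ HBs _ _].
  pose proof (rate_pos g hg _ Hl) as Hgl.
  assert (Hd : 0 < bM / g (power eM bM)) by (apply Rdiv_lt_0_compat; assumption).
  pose proof (RInt_power_phase g M tM eM bM (completion tM eM bM) (rate_0 _ hg)
    HP Hd ltac:(lra) (Rlt_le _ _ Hl) HM (or_intror Hlast)) as [_ IB].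
  rewrite Rmin_left in IB by lra.
  exists (completion tM eM bM). split; [split; [lra|]|].
  2: { unfold bits_sent in *. rewrite IB, HBs.
       assert (g (power eM bM) * (bM / g (power eM bM)) = bM) by (field; lra).
       lra. }
  destruct (Rle_or_lt (completion tM eM bM) T) as [L|L]; [lra|].
  (* The phase in force at [T]. It is sought no later than the last phase [M], so that
     [completion_mono] bounds the final completion by its own. *)
  assert (Hcov : exists m t e b, (m <= M)%nat /\ phase m = Some (t, e, b) /\
    t <= T /\ total sigma T = total sigma t).
  { assert (H : forall n t e b, phase n = Some (t, e, b) -> (n <= M)%nat ->
      T < t -> exists m t e b, (m <= M)%nat /\ phase m = Some (t, e, b) /\
      t <= T /\ total sigma T = total sigma t).
    { induction n as [|n IH]; intros t1 e1 b1 Hn HnM HTt.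
      - rewrite H0 in Hn. injection Hn as <- <- <-. lra.
      - apply phase_S in Hn as [t2 [e2 [b2 [H2 [En _]]]]].
        destruct (Rle_or_lt t2 T) as [L2|L2].
        + exists n, t2, e2, b2. repeat split; auto; [lia|].
          apply total_before_next; [exact L2|]. rewrite En. exact HTt.
        + exact (IH _ _ _ H2 ltac:(lia) L2). }
    destruct (Rle_or_lt tM T) as [L'|L'].
    - exists M, tM, eM, bM. repeat split; auto.
      apply total_before_next; [exact L'|].
      apply Rbar_lt_le_trans with (2 := Hlast). exact L.
    - exact (H M tM eM bM HM ltac:(lia) L'). }
  destruct Hcov as [m [t [e [b [HmM [Hm [HtT HE]]]]]]].
  destruct (completion_mono ts _ m M _ _ _ _ _ _ H0 HmM Hm HM) as [_ Hmono].
  destruct (phase_invariant_all ts _ m t e b H0 Hm) as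
    [[_ Htst'] He' Hb' Hl' Hex' Heff HP' HEu _ _ _].
  rewrite (phase_duration e b He' Hl' Hex') in Hmono.
  set (l := power e b) in *. rewrite HE in HB.
  assert (HEe : e <= total sigma t).
  { pose proof (RInt_power_nonneg (fun p => p) 0 t t P HP' (fun p H => H)
      ltac:(lra) ltac:(lra)) as HU.
    change (0 <= energy_used P t) in HU. lra. }
  set (E := total sigma t) in *.
  assert (HET : 0 < E / T) by (apply Rdiv_lt_0_compat; lra).
  assert (Hle : E / T <= l).
  (* [inv_efficiency] and the hypothesis on [B0] give [E * (g l / l) <= B0 <= E * (g (E / T) / (E /
     T))]. *)
  { apply (ratio_le_inv g hg); [exact Hl'|exact HET|].
    apply Rmult_le_reg_l with E; [lra|].
    replace (E * (g (E / T) / (E / T))) with (T * g (E / T)) by (field; lra).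
    lra. }
  apply Rle_div_l in Hle; [|exact HT].
  assert (e / l <= T) by (apply Rle_div_l; lra).
  lra.
Qed.

End Input.

(** * Causality of ON *)

Lemma T_start_same t sigma sigma' rho rho' ts :
  same_until t sigma sigma' -> same_until t rho rho' -> ts <= t ->
  T_start g B0 sigma rho = Finite ts -> T_start g B0 sigma' rho' = Finite ts.
Proof.
  intros Hs Hr Hle Hts.
  destruct (T_start_cases sigma rho) as [[E _]|[x [E [Hx [Hen Hmin]]]]];
    rewrite Hts in E; [discriminate|injection E as <-].
  rewrite (total_same t sigma sigma' ts Hs Hle),
    (total_same t rho rho' ts Hr Hle) in Hen.
  destruct (T_start_cases sigma' rho') as [[_ Hno]|[y [E [Hy [Hen' Hmin']]]]].
  - exfalso. exact (Hno ts Hx Hen).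
  - rewrite E. f_equal. destruct (Rtotal_order y ts) as [L|[->|L]].
    + exfalso. apply (Hmin y (conj Hy L)).
      rewrite (total_same t sigma sigma' y Hs ltac:(lra)),
        (total_same t rho rho' y Hr ltac:(lra)). exact Hen'.
    + reflexivity.
    + exfalso. exact (Hmin' ts (conj Hx L) Hen).
Qed.

Lemma phase_same t sigma sigma' rho rho' m : forall tm e b,
  same_until t sigma sigma' -> same_until t rho rho' -> tm <= t ->
  ON_phase g B0 sigma rho m = Some (tm, e, b) ->
  ON_phase g B0 sigma' rho' m = Some (tm, e, b).
Proof.
  induction m as [|m IH]; intros tm e b Hs Hr Hle Hm.
  - apply phase_0 in Hm as [Hts [-> ->]]. apply phase_0.
    split; [exact (T_start_same t sigma sigma' rho rho' tm Hs Hr Hle Hts)|].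
    split; [|reflexivity]. exact (total_same t sigma sigma' tm Hs Hle).
  - apply phase_S in Hm as [t0 [e0 [b0 [H0 [En [Hc [He Hb]]]]]]].
    pose proof (next_arrival_gt sigma t0) as Hgt. rewrite En in Hgt. simpl in Hgt.
    apply phase_S. exists t0, e0, b0.
    split; [apply (IH t0 e0 b0 Hs Hr ltac:(lra) H0)|].
    split; [exact (next_arrival_same t sigma sigma' t0 tm Hs Hle En)|].
    split; [exact Hc|]. split; [|exact Hb].
    rewrite <- (total_same t sigma sigma' tm Hs Hle).
    rewrite <- (total_same t sigma sigma' t0 Hs ltac:(lra)). exact He.
Qed.

Lemma ON_transmits_same t sigma sigma' rho rho' u l :
  same_until t sigma sigma' -> same_until t rho rho' -> u <= t ->
  ON_transmits g B0 sigma rho u l -> ON_transmits g B0 sigma' rho' u l.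
Proof.
  intros Hs Hr Hle [m [t0 [e [b [Hm [Hl [Hu Hn]]]]]]].
  exists m, t0, e, b. repeat split; try assumption; try apply Hu.
  - apply (phase_same t sigma sigma' rho rho' m); try assumption. lra.
  - exact (next_arrival_same_lt t sigma sigma' t0 u Hs Hle Hn).
Qed.

Lemma ON_online : online (ON g B0).
Proof.
  constructor.
  - intros sigma rho T HT. apply ON_run_spec. lra.
  - intros sigma rho t Ht. apply ON_run_spec. exact Ht.
  - intros t sigma sigma' rho rho' Hs Hr u [_ Hu]. unfold ON.
    destruct (classic (exists l, ON_transmits g B0 sigma rho u l)) as [[l Hl]|Hno].
    + rewrite (ON_power_eq sigma rho u l Hl). symmetry. apply ON_power_eq.
      exact (ON_transmits_same t _ _ _ _ u l Hs Hr Hu Hl).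
    + rewrite (ON_power_off sigma rho), (ON_power_off sigma' rho'); [reflexivity| |].
      * intros l Hl. apply Hno. exists l.
        exact (ON_transmits_same t _ _ _ _ u l (same_until_sym _ _ _ Hs)
          (same_until_sym _ _ _ Hr) Hu Hl).
      * intros l Hl. apply Hno. exists l. exact Hl.
Qed.

End ON_run.

(** * The two bounds on the competitive ratio *)

Lemma Rbar_lub_upper (E : Rbar -> Prop) x : E x -> Rbar_le x (Rbar_lub E).
Proof. apply (proj2_sig (Rbar_ex_lub E)). Qed.

Lemma offline_feasible_spec g B0 sigma rho T :
  offline_feasible g B0 sigma rho T ->
  0 < T /\ exists P, powers_on 0 T P /\ bits_sent g P T = B0 /\
    forall t, 0 <= t <= T -> respects sigma rho P t.
Proof.
  intros [s [P [[Hs [HP H0]] [HB Hr]]]]. split; [lra|]. exists P.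
  split; [|split; assumption].
  apply powers_on_concat with s; [|exact HP].
  apply powers_on_const with 0; try lra. intros t Ht. apply H0. lra.
Qed.

Section Ratio.

Variables (g : R -> R) (B0 : R).
Hypothesis hg : rate_function g.
Hypothesis hB0 : 0 < B0.

(** Jensen's inequality, obtained from the supporting line at the average power [E / D]. *)
Lemma power_bits_bound T P D E :
  powers_on 0 T P -> 0 <= T -> 0 < D -> 0 < E ->
  energy_used P T <= E -> on_time P T <= D -> bits_sent g P T <= D * g (E / D).
Proof.
  intros HP HT HD HE HU HC.
  assert (HED : 0 < E / D) by (apply Rdiv_lt_0_compat; assumption).
  destruct (supporting_exists g hg (E / D) HED) as [c [m Hsup]].
  apply (bits_bound g c m (E / D) D T P hg Hsup HP HT); [|exact HC].
  replace (D * (E / D)) with E by (field; lra). exact HU.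
Qed.

Lemma ON_finish_time sigma rho T :
  offline_feasible g B0 sigma rho T ->
  exists f, finish_time g B0 (ON g B0 sigma rho) = Finite f /\ f <= 2 * T.
Proof.
  intros Hf.
  destruct (offline_feasible_spec _ _ _ _ _ Hf) as [HT [P [HP [HB Hr]]]].
  destruct (Hr T ltac:(lra)) as [HU HC].
  pose proof (total_pos sigma T ltac:(lra)) as HE.
  pose proof (total_pos rho T ltac:(lra)) as HG.
  (* With the on-time received, the bound shows that ON has started by [T]; with [T] itself as the
     on-time, it gives the hypothesis of [ON_finish]. *)
  pose proof (power_bits_bound T P _ _ HP ltac:(lra) HG HE HU HC) as H1.
  pose proof (on_time_step P 0 T HP ltac:(lra)) as HCT.
  rewrite (proj2 (proj2 (proj2 (idle g P 0 hg (Rle_refl 0)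
    ltac:(intros; lra))))) in HCT.
  pose proof (power_bits_bound T P T _ HP ltac:(lra) HT HE HU ltac:(lra)) as H2.
  rewrite HB in H1, H2.
  destruct (T_start_cases g B0 sigma rho) as [[_ Hno]|[ts [Hts [_ [_ Hmin]]]]].
  { exfalso. exact (Hno T ltac:(lra) H1). }
  assert (HtsT : ts <= T).
  { destruct (Rle_or_lt ts T) as [L|L]; [exact L|].
    exfalso. apply (Hmin T); [lra|exact H1]. }
  destruct (ON_finish g B0 hg hB0 sigma rho ts T Hts HtsT HT H2)
    as [c [Hc HBc]].
  destruct (Glb_Rbar_correct
    (fun t => 0 <= t /\ B0 <= bits_sent g (ON g B0 sigma rho) t)) as [Hlb Hglb].
  fold (finish_time g B0 (ON g B0 sigma rho)) in Hlb, Hglb.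
  pose proof (Hlb c (conj (proj1 Hc) HBc)) as Hle.
  assert (Hge : Rbar_le 0 (finish_time g B0 (ON g B0 sigma rho))).
  { apply Hglb. intros t [Ht _]. exact Ht. }
  destruct (finish_time g B0 (ON g B0 sigma rho)) as [f| |]; try contradiction.
  exists f. split; [reflexivity|]. simpl in Hle. lra.
Qed.

Lemma ON_competitive_ratio : Rbar_le (competitive_ratio g B0 (ON g B0)) 2.
Proof.
  apply (proj2 (proj2_sig (Rbar_ex_lub _))).
  intros r [sigma [rho [T [[Hf _] ->]]]].
  destruct (ON_finish_time sigma rho T Hf) as [f [-> Hle]].
  destruct (offline_feasible_spec _ _ _ _ _ Hf) as [HT _].
  simpl. apply Rle_div_l; lra.
Qed.

Lemma ratio_ge (F : Rbar) (T x : R) :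
  0 < T -> Rbar_le (x * T) F -> Rbar_le x (Rbar_div F T).
Proof.
  intros HT HF. destruct F as [f| |]; [| |contradiction].
  - simpl in *. apply Rle_div_r; lra.
  - pose proof (Rinv_0_lt_compat T HT). simpl.
    destruct (Rle_dec 0 (/ T)) as [L|L]; [|lra].
    destruct (Rle_lt_or_eq_dec 0 (/ T) L); [exact I|lra].
Qed.

Lemma never_finishes P :
  (forall t, 0 <= t -> bits_sent g P t < B0) -> finish_time g B0 P = p_infty.
Proof.
  intros H. apply Rbar_le_antisym; [destruct (finish_time g B0 P); exact I|].
  apply (proj2 (Glb_Rbar_correct _)). intros t [Ht HB].
  pose proof (H t Ht). lra.
Qed.

Lemma constant_policy s T q :
  0 <= s < T -> 0 < q -> exists P, policy s T P /\
    forall t, 0 <= t <= T ->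
      energy_used P t = q * Rmax 0 (t - s) /\
      bits_sent g P t = g q * Rmax 0 (t - s) /\
      on_time P t = Rmax 0 (t - s).
Proof.
  intros Hs Hq.
  pose (P := fun t => if Rle_dec s t then if Rlt_dec t T then q else 0 else 0).
  assert (Hoff : forall t, t < s \/ T <= t -> P t = 0).
  { intros t Ht. unfold P. destruct (Rle_dec s t); [|reflexivity].
    destruct (Rlt_dec t T); [lra|reflexivity]. }
  assert (Hon : forall t, s <= t < T -> P t = q).
  { intros t Ht. unfold P. destruct (Rle_dec s t); [|lra].
    destruct (Rlt_dec t T); lra. }
  exists P. split.
  - split; [exact Hs|]. split; [|exact Hoff].
    apply powers_on_const with q; [lra|lra|exact Hon].
  - intros t Ht. destruct (Rle_or_lt t s) as [L|L].
    + destruct (idle g P t hg (proj1 Ht)) as [_ [-> [-> ->]]].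
      { intros w Hw. apply Hoff. lra. }
      rewrite Rmax_left by lra. lra.
    + rewrite Rmax_right by lra.
      destruct (idle g P s hg (proj1 Hs)) as [HP0 [HE0 [HB0' HC0]]].
      { intros w Hw. apply Hoff. lra. }
      assert (Hc : forall w, s <= w < t -> P w = q) by (intros; apply Hon; lra).
      pose proof (RInt_power_extend (fun p => p) P s t q HP0 (Rlt_le _ _ L) Hc) as IE.
      pose proof (RInt_power_extend g P s t q HP0 (Rlt_le _ _ L) Hc) as IB.
      pose proof (RInt_power_extend is_on P s t q HP0 (Rlt_le _ _ L) Hc) as IC.
      change (energy_used P t = energy_used P s + q * (t - s)) in IE.
      change (bits_sent g P t = bits_sent g P s + g q * (t - s)) in IB.
      change (on_time P t = on_time P s + is_on q * (t - s)) in IC.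
      rewrite IE, IB, IC. unfold is_on. destruct (Req_EM_T q 0); lra.
Qed.

(** * The adversary against an arbitrary online algorithm *)

Section Adversary.

Variable A : algorithm.
Hypothesis hA : online A.

Lemma online_powers_on sigma rho T : 0 <= T -> powers_on 0 T (A sigma rho).
Proof.
  intros HT. destruct (Rle_lt_or_eq_dec 0 T HT) as [L|<-].
  - exact (online_powers _ hA sigma rho T L).
  - apply powers_on_nil.
Qed.

(** Bits sent never decrease, so it suffices to look at times after [u], when a deviation at [u]
    lies inside the interval of integration. *)
Lemma online_never_finishes sigma rho (u : R) :
  0 <= u ->
  (forall T, u < T -> bits_sent g (A sigma rho) T < B0) ->
  finish_time g B0 (A sigma rho) = p_infty.
Proof.
  intros Hu H. apply never_finishes. intros t Ht.
  pose proof (Rmax_l t (u + 1)). pose proof (Rmax_r t (u + 1)).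
  apply Rle_lt_trans with (bits_sent g (A sigma rho) (Rmax t (u + 1))).
  - apply (RInt_power_mono g); [|exact (rate_nonneg _ hg)|lra].
    apply online_powers_on. lra.
  - apply H. lra.
Qed.

Section Power_levels.

Variables q q' c m : R.
Hypothesis Hq : 0 < q < q'.
Hypothesis Hsup : supporting g c m q.
Hypothesis Hexp : forall p, q < p -> g p < c + m * p.
Hypothesis Hclose : g q' < 2 * g q.

(** [G] is below [D'] because [D' < D], positive by [Hclose], and satisfies [G + D = 2 * D'], so
    that silence until [G] on the calm input costs a ratio of at least [2 * D' / D]. *)
Let D := B0 / g q.
Let D' := B0 / g q'.
Let G := 2 * D' - D.

(** The larger power needs less time but, having the smaller ratio, more energy for the same
    bits. *)
Lemma durations :
  D * g q = B0 /\ D' * g q' = B0 /\ D' < D < 2 * D' /\ D * q < D' * q'.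
Proof.
  pose proof (rate_pos g hg q (proj1 Hq)) as Hg.
  pose proof (rate_strict g hg q q' ltac:(lra)) as Hgg.
  assert (E : D * g q = B0) by (unfold D; field; lra).
  assert (E' : D' * g q' = B0) by (unfold D'; field; lra).
  assert (HD : 0 < D) by (apply Rdiv_lt_0_compat; lra).
  assert (HD' : 0 < D') by (apply Rdiv_lt_0_compat; lra).
  repeat split; try assumption; try nra.
  pose proof (ratio_strict g hg q q' Hq) as Hr.
  assert (Hx : D * q * (g q / q) = D' * q' * (g q' / q')).
  { replace (D * q * (g q / q)) with (D * g q) by (field; lra).
    replace (D' * q' * (g q' / q')) with (D' * g q') by (field; lra). lra. }
  pose proof (ratio_pos g hg q' ltac:(lra)) as Hr'.
  assert (0 < D * q) by nra. nra.
Qed.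

(* The receiver obtains the on-time it lacks at [G], just before [D]. *)
Lemma calm_input :
  exists sigma rho : arrivals,
    (forall i, sigma i = match i with O => Some (0, D * q) | _ => None end) /\
    (forall i, rho i = match i with
       | O => Some (0, G) | S O => Some (G, D - G) | _ => None end) /\
    offline_optimum g B0 sigma rho D /\
    (forall u, 0 <= u < G -> A sigma rho u <> 0 -> A sigma rho u <> q ->
       finish_time g B0 (A sigma rho) = p_infty) /\
    ((forall u, 0 <= u < G -> A sigma rho u = 0) ->
       Rbar_le (G + D) (finish_time g B0 (A sigma rho))).
Proof.
  destruct durations as [E [E' [HD _]]].
  assert (HG : 0 < G < D) by (unfold G; lra).
  destruct (one_arrival (D * q) ltac:(nra)) as [sigma [Hs Hst]].
  destruct (two_arrivals G G (D - G) ltac:(lra) ltac:(lra) ltac:(lra))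
    as [rho [Hr [Hrt0 Hrt1]]].
  assert (Hrho : forall t, 0 <= t -> total rho t <= D).
  { intros t Ht. destruct (Rlt_or_le t G) as [L|L];
      [rewrite Hrt0|rewrite Hrt1]; lra. }
  exists sigma, rho. split; [exact Hs|]. split; [exact Hr|].
  split; [|split].
  - split.
    + destruct (constant_policy 0 D q ltac:(lra) ltac:(lra)) as [P [HP Hacc]].
      exists 0, P. split; [exact HP|]. split.
      * destruct (Hacc D ltac:(lra)) as [_ [-> _]].
        rewrite Rmax_right by lra. lra.
      * intros t Ht. destruct (Hacc t Ht) as [HE [_ HC]]. split.
        -- rewrite HE, Hst by lra. rewrite Rmax_right by lra. nra.
        -- rewrite HC, Rmax_right by lra. destruct (Rlt_or_le t G) as [L|L];
             [rewrite Hrt0|rewrite Hrt1]; lra.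
    + intros T HT.
      destruct (offline_feasible_spec _ _ _ _ _ HT) as [HT0 [P [HP [HB Hresp]]]].
      destruct (Hresp T ltac:(lra)) as [HU HC]. rewrite Hst in HU by lra.
      (* The energy [D * q] forces on-time at least [D], and on-time never exceeds elapsed time. *)
      pose proof (on_time_ge g c m q D T P hg Hsup HP ltac:(lra) HU ltac:(lra)).
      pose proof (on_time_step P 0 T HP ltac:(lra)) as HCT.
      rewrite (proj2 (proj2 (proj2 (idle g P 0 hg (Rle_refl 0)
        ltac:(intros; lra))))) in HCT.
      lra.
  - intros u Hu H0 Hne. apply (online_never_finishes sigma rho u); [lra|].
    intros T HT. rewrite <- E.
    destruct (online_respects _ hA sigma rho T ltac:(lra)) as [HU HC].
    rewrite Hst in HU by lra. pose proof (Hrho T ltac:(lra)).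
    apply (exposed_bits_bound g c m q D T (A sigma rho) hg Hsup) with u;
      try assumption; try lra.
    apply online_powers_on. lra.
  - intros Hidle. apply (proj2 (Glb_Rbar_correct _)). intros t [Ht HB]. simpl.
    pose proof (online_powers_on sigma rho t Ht) as HP.
    destruct (online_respects _ hA sigma rho t Ht) as [HU HC].
    rewrite Hst in HU by lra.
    pose proof (on_time_ge g c m q D t _ hg Hsup HP Ht HU ltac:(lra)) as Hon.
    (* All of the required on-time [D] must fall after [G]. *)
    destruct (Rle_or_lt t G) as [L|L].
    + destruct (idle g (A sigma rho) t hg Ht) as [_ [_ [_ HC0]]].
      { intros w Hw. apply Hidle. lra. }
      lra.
    + destruct (idle g (A sigma rho) G hg ltac:(lra) Hidle) as [_ [_ [_ HC0]]].
      pose proof (on_time_step (A sigma rho) G t HP ltac:(lra)). lra.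
Qed.

(* More energy arrives at [G] than with the calm input, but less on-time is
   available, so that only power [q'] (and not [q]) can be used. *)
Lemma rich_input :
  exists sigma rho : arrivals, exists T,
    (forall i, sigma i = match i with
       | O => Some (0, D * q) | S O => Some (G, D' * q' - D * q) | _ => None end) /\
    (forall i, rho i = match i with
       | O => Some (0, G) | S O => Some (2 * G, D' - G) | _ => None end) /\
    offline_optimum g B0 sigma rho T /\
    (forall u, 0 <= u < G -> A sigma rho u = q ->
       finish_time g B0 (A sigma rho) = p_infty).
Proof.
  destruct durations as [E [E' [HD Henergy]]].
  assert (HG : 0 < G < D') by (unfold G; lra).
  destruct (two_arrivals (D * q) G (D' * q' - D * q) ltac:(nra) ltac:(lra)
    ltac:(lra)) as [sigma [Hs [Hst0 Hst1]]].
  destruct (two_arrivals G (2 * G) (D' - G) ltac:(lra) ltac:(lra) ltac:(lra))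
    as [rho [Hr [Hrt0 Hrt1]]].
  assert (Hsigma : forall t, 0 <= t -> total sigma t <= D' * q').
  { intros t Ht. destruct (Rlt_or_le t G) as [L|L];
      [rewrite Hst0|rewrite Hst1]; lra. }
  assert (Hrho : forall t, 0 <= t -> total rho t <= D').
  { intros t Ht. destruct (Rlt_or_le t (2 * G)) as [L|L];
      [rewrite Hrt0|rewrite Hrt1]; lra. }
  destruct (supporting_exists g hg q' ltac:(lra)) as [c' [m' Hsup']].
  exists sigma, rho, (G + D'). split; [exact Hs|]. split; [exact Hr|].
  split; [split|].
  (* Power [q'] from [G] on: the initial on-time [G] lasts exactly until [2 * G], when the rest
     [D' - G] arrives. *)
  - destruct (constant_policy G (G + D') q' ltac:(lra) ltac:(lra))
      as [P [HP Hacc]].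
    exists G, P. split; [exact HP|]. split.
    + destruct (Hacc (G + D') ltac:(lra)) as [_ [-> _]].
      rewrite Rmax_right by lra. lra.
    + intros t Ht. destruct (Hacc t Ht) as [HE [_ HC]].
      pose proof (total_pos sigma t (proj1 Ht)).
      pose proof (total_pos rho t (proj1 Ht)). split.
      * rewrite HE. destruct (Rlt_or_le t G) as [L|L].
        -- rewrite Rmax_left by lra. lra.
        -- rewrite Rmax_right, Hst1 by lra. nra.
      * rewrite HC. destruct (Rlt_or_le t G) as [L|L].
        -- rewrite Rmax_left by lra. lra.
        -- rewrite Rmax_right by lra. destruct (Rlt_or_le t (2 * G)) as [L'|L'];
             [rewrite Hrt0|rewrite Hrt1]; lra.
  - intros T HT.
    destruct (offline_feasible_spec _ _ _ _ _ HT) as [HT0 [P [HP [HB Hresp]]]].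
    destruct (Hresp T ltac:(lra)) as [HU _].
    pose proof (Hsigma T ltac:(lra)).
    pose proof (on_time_ge g c' m' q' D' T P hg Hsup' HP ltac:(lra) ltac:(lra)
      ltac:(lra)) as Hon.
    destruct (Rle_or_lt (G + D') T) as [L|L]; [exact L|exfalso].
    (* an instant just before [2 G], up to which only [G] is available *)
    pose (t := Rmin T (2 * G - Rmin G ((G + D' - T) / 2))).
    pose proof (Rmin_l T (2 * G - Rmin G ((G + D' - T) / 2))) as Ht1.
    pose proof (Rmin_r T (2 * G - Rmin G ((G + D' - T) / 2))) as Ht2.
    pose proof (Rmin_l G ((G + D' - T) / 2)) as Hd1.
    pose proof (Rmin_r G ((G + D' - T) / 2)) as Hd2.
    assert (Hd0 : 0 < Rmin G ((G + D' - T) / 2)) by (apply Rmin_glb_lt; lra).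
    fold t in Ht1, Ht2.
    assert (Ht0 : 0 <= t) by (apply Rmin_glb; lra).
    destruct (Hresp t ltac:(lra)) as [_ HC]. rewrite Hrt0 in HC by lra.
    pose proof (on_time_step P t T HP ltac:(lra)) as Hstep.
    (* If [t] is not [T], its distance to [2 * G] is at most half of the assumed shortfall
       [G + D' - T]. Fewer than [D' - G] time units thus remain, while at most [G] of the required
       [D'] was available up to [t]. *)
    assert (Ht : T - t < D' - G).
    { unfold t, Rmin at 1. destruct (Rle_dec T _); lra. }
    lra.
  - intros u Hu HA. apply (online_never_finishes sigma rho u); [lra|].
    intros T HT. rewrite <- E'.
    destruct (online_respects _ hA sigma rho T ltac:(lra)) as [HU HC].
    pose proof (Hsigma T ltac:(lra)). pose proof (Hrho T ltac:(lra)).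
    apply (bits_bound_strict g c' m' q' D' T (A sigma rho) hg Hsup') with u;
      try lra.
    + apply online_powers_on. lra.
    + rewrite HA. unfold loss, is_on. destruct (Req_EM_T q 0); [lra|].
      pose proof (exposed_misses g hg q c m q' c' m' Hq Hsup
        (Hexp q' (proj2 Hq)) Hsup'). lra.
Qed.

(** The calm input serves as reference, and the rich input replaces it only if power [q] is seen
    before [G]. *)
Lemma adversary_input :
  exists sigma rho T, offline_optimum g B0 sigma rho T /\
    Rbar_le (2 * g q / g q')
      (Rbar_div (finish_time g B0 (A sigma rho)) (Finite T)).
Proof.
  destruct durations as [E [E' [HD _]]].
  assert (HG : 0 < G < D) by (unfold G; lra).
  destruct calm_input as [sigma [rho [Hs [Hr [Hopt [Hstuck Hidle]]]]]].
  destruct (classic (exists u, 0 <= u < G /\ A sigma rho u <> 0))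
    as [[u [Hu H0]]|Hno].
  - destruct (Req_EM_T (A sigma rho u) q) as [Eq|Hne].
    + destruct rich_input as [sigma' [rho' [T [Hs' [Hr' [Hopt' Hstuck']]]]]].
      exists sigma', rho', T. split; [exact Hopt'|].
      destruct (offline_feasible_spec _ _ _ _ _ (proj1 Hopt')) as [HT _].
      apply ratio_ge; [exact HT|]. rewrite (Hstuck' u Hu); [exact I|].
      (* The two inputs differ only from [G] on and [u < G], so causality transfers the use of power
         [q]. *)
      rewrite <- Eq. symmetry. apply (online_causal _ hA u); [| |lra].
      * intros [|[|i]] w y Hw; rewrite Hs, Hs'; [reflexivity| |reflexivity].
        split; [discriminate|]. intros Ew. injection Ew as <- _. lra.
      * intros [|[|i]] w y Hw; rewrite Hr, Hr'; [reflexivity| |reflexivity].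
        split; intros Ew; injection Ew as <- _; lra.
    + exists sigma, rho, D. split; [exact Hopt|].
      apply ratio_ge; [lra|]. rewrite (Hstuck u Hu H0 Hne). exact I.
  - exists sigma, rho, D. split; [exact Hopt|].
    apply ratio_ge; [lra|]. apply Rbar_le_trans with (G + D).
    + simpl. right. unfold G, D, D'.
      pose proof (rate_pos g hg q (proj1 Hq)).
      pose proof (rate_pos g hg q' ltac:(lra)). field. lra.
    + apply Hidle. intros u Hu. apply NNPP. intros H0. apply Hno.
      exists u. auto.
Qed.

End Power_levels.

Lemma online_competitive_ratio : Rbar_le 2 (competitive_ratio g B0 A).
Proof.
  destruct (exposed_exists g hg) as [q [c [m [Hq [Hsup Hexp]]]]].
  pose proof (rate_pos g hg q Hq) as Hg.
  pose proof (Rbar_lub_upper _ : forall x, _ -> Rbar_le x (competitive_ratio g B0 A))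
    as Hub.
  revert Hub. generalize (competitive_ratio g B0 A). intros l Hub.
  assert (H : forall r, 1 <= r < 2 -> Rbar_lt r l).
  { intros r Hr. pose proof Hsup as [Hc [Hm [Eq _]]].
    (* Chosen so that [r * (g q + m * d) = (1 + r / 2) * g q], which is below [2 * g q] for [r < 2];
       the supporting line bounds [g (q + d)] by [g q + m * d]. *)
    pose (d := (2 - r) * g q / (2 * r * m)).
    assert (Hd : 0 < d) by (apply Rdiv_lt_0_compat; nra).
    assert (Hdm : r * (m * d) = (2 - r) * g q / 2) by (unfold d; field; lra).
    pose proof (Hexp (q + d) ltac:(lra)) as Hgd.
    assert (Hlt : r * g (q + d) < 2 * g q) by nra.
    pose proof (rate_pos g hg (q + d) ltac:(lra)) as Hgp.
    destruct (adversary_input q (q + d) c m ltac:(lra) Hsup Hexp ltac:(nra))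
      as [sigma [rho [T [Hopt Hle]]]].
    apply Rbar_lt_le_trans with (2 * g q / g (q + d)).
    - simpl. apply Rlt_div_r; lra.
    - apply Rbar_le_trans with (1 := Hle). apply Hub.
      exists sigma, rho, T. auto. }
  (* A finite [l] below 2 would be strictly below itself on taking [r = l], which is admissible
     since [r = 1] gives [1 < l]. *)
  destruct l as [l| |]; [|exact I|exact (H 1 ltac:(lra))].
  destruct (Rle_or_lt 2 l) as [L|L]; [exact L|].
  pose proof (H 1 ltac:(lra)) as H1. simpl in H1.
  pose proof (H l ltac:(lra)) as Hl. simpl in Hl. lra.
Qed.

End Adversary.

End Ratio.

Theorem theorem5 (g : R -> R) (B0 : R) (hg : rate_function g) (hB0 : 0 < B0) :
  optimal_online g B0 (ON g B0).
Proof.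
  split; [exact (ON_online g B0 hg hB0)|].
  intros A hA. apply Rbar_le_trans with 2.
  - exact (ON_competitive_ratio g B0 hg hB0).
  - exact (online_competitive_ratio g B0 hg hB0 A hA).
Qed.
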